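(* There exists an absolute constant $\kappa>1/100$ such that the following holds. Let $b\ge2$, $\theta=1/\sqrt b$, $\beta_c=\operatorname{arctanh}\theta$, let $0<\alpha<1/2$ and $h$ be such that $\ell=\alpha h$ is a positive integer, and put $r=h-\ell$. For any boundary condition $\tau$ on the leaves of the $b$-ary tree of height $h$, the spectral gap of the block dynamics with blocks $\mathcal B$ (defined below) for the Ising model at inverse temperature $\beta_c$ satisfies $$\mathrm{gap}^\tau_{\mathcal B}\ge\frac1{4(b^\ell+1)}\Big(1-\frac{\alpha}{\kappa(1-\theta)(1-2\alpha)}\Big).$$
   Context: The $b$-ary tree of height $h$ is the rooted tree with root $\rho$ in which every vertex at distance less than $h$ from $\rho$ has exactly $b$ children; $H_k$ is the set of vertices at distance $k$ from $\rho$, and the leaves $H_h$ carry the boundary condition $\tau$. The Ising Gibbs measure $\mu^\tau$ has density $\propto\exp(\beta\sum_{uv}\sigma(u)\sigma(v))$ conditioned on agreeing with $\tau$ on the leaves. For a vertex $v$ and $k\ge1$, $B(v,k)$ is the set of descendants $u$ of $v$ (including $v$) with $\mathrm{dist}(v,u)\le k-1$. The blocks are $\mathcal B=\{B(v,r):v\in H_\ell\cup\{\rho\}\}$ ($b^\ell+1$ blocks, covering all non-leaf vertices). The (discrete-time) block dynamics: at each step one block is chosen uniformly at random and all its spins are resampled jointly from $\mu^\tau$ conditioned on all spins outside the block. $\mathrm{gap}$ denotes $1-\lambda$, $\lambda$ the largest nontrivial eigenvalue. *)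

(* Defs.v *)
From Stdlib Require Import Reals.
From mathcomp Require Import all_boot.
Set Implicit Arguments. Unset Strict Implicit. Unset Printing Implicit Defensive.

Local Open Scope R_scope.

Definition atanh (x : R) : R := / 2 * ln ((1 + x) / (1 - x)).

Definition Rsum {T : Type} (s : seq T) (F : T -> R) : R :=
  foldr (fun x a => F x + a) 0 s.

(* Vertices of the b-ary tree of height h: words w in {0..b-1}^k, 0 <= k <= h.
   The root is the empty word; the children of w are the words w ++ [i]. *)
Definition vtx (b h : nat) : finType := {k : 'I_h.+1 & k.-tuple 'I_b}.

Definition depth {b h} (v : vtx b h) : nat := tag v.
Definition word {b h} (v : vtx b h) : seq nat := map (@nat_of_ord b) (tagged v).

Definition child {b h} (u v : vtx b h) : bool :=
  (depth u == (depth v).+1) && (word v == take (depth v) (word u)).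

Definition desc {b h} (u v : vtx b h) : bool :=
  (depth v <= depth u)%N && (word v == take (depth v) (word u)).

(* u \in B(v,k): u descendant of v with dist(v,u) = depth u - depth v <= k-1 *)
Definition inB {b h} (v : vtx b h) (k : nat) (u : vtx b h) : bool :=
  desc u v && (depth u < depth v + k)%N.

Definition is_leaf {b h} (v : vtx b h) : bool := depth v == h.

Definition config (b h : nat) : finType := {ffun vtx b h -> bool}.

Definition spin {b h} (s : config b h) (v : vtx b h) : R :=
  if s v then 1 else -1.

Definition Omega {b h} (tau : config b h) : seq (config b h) :=
  [seq s : config b h <- enum (config b h) | [forall v, is_leaf v ==> (s v == tau v)]].

Definition energy {b h} (s : config b h) : R :=
  Rsum (enum (vtx b h)) (fun u =>
    Rsum (enum (vtx b h)) (fun v => if child u v then spin s u * spin s v else 0)).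

Definition weight {b h} (beta : R) (s : config b h) : R := exp (beta * energy s).

Definition mu {b h} (beta : R) (tau : config b h) (s : config b h) : R :=
  weight beta s / Rsum (Omega tau) (weight beta).

Definition agree_off {b h} (v : vtx b h) (k : nat) (s s' : config b h) : bool :=
  [forall u, ~~ inB v k u ==> (s u == s' u)].

(* heat-bath update of the block B(v,k): resample from mu^tau conditioned on
   the spins outside the block *)
Definition block_kernel {b h} (beta : R) (tau : config b h) (v : vtx b h) (k : nat)
    (s s' : config b h) : R :=
  if agree_off v k s s' then
    mu beta tau s' / Rsum [seq e : config b h <- Omega tau | agree_off v k s e] (mu beta tau)
  else 0.

Definition centers (b h l : nat) : seq (vtx b h) :=
  [seq v <- enum (vtx b h) | (depth v == 0)%N || (depth v == l)%N].

Definition block_P {b h} (beta : R) (tau : config b h) (l r : nat)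
    (s s' : config b h) : R :=
  / INR (size (centers b h l)) *
  Rsum (centers b h l) (fun v => block_kernel beta tau v r s s').

Definition nontrivial_eigenvalue {b h} (beta : R) (tau : config b h) (l r : nat)
    (lam : R) : Prop :=
  exists f : config b h -> R,
    (exists s, s \in Omega tau /\ f s <> 0) /\
    Rsum (Omega tau) (fun s => mu beta tau s * f s) = 0 /\
    (forall s, s \in Omega tau ->
       Rsum (Omega tau) (fun s' => block_P beta tau l r s s' * f s') = lam * f s).

(* Main.v *)
(** The gap is governed by the maximal correlation between the spins above level
    [l] and those from level [r] on.  Conditionally on the spin of a vertex [v],
    let [P+] and [P-] be the laws of the spins below [v] from level [r] on, and
    let [H] be their Hellinger affinity.  [H] is multiplicative over the children
    of [v], and one Ising edge maps [1 - H^2] to at most [theta^2 (1 - H^2)],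
    whatever the fields coming from the boundary condition.  At
    [b theta^2 = 1] this yields the recursion [d' <= 1 - (1 - d/b)^b <= d - d^2/4]
    for [d = 1 - H^2], hence [d <= 4/(n+3)] at height [n] above level [r].
    By Cauchy-Schwarz [1 - H^2] bounds the squared maximal correlation of the spin
    at [v] with those below, for every prior; revealing the top levels one at a
    time, and tensorizing over siblings, the squared correlation between top and
    bottom is at most [4 l / (r - l)], and the block dynamics inherits the gap. *)

Require Import Defs.
From Stdlib Require Import Reals.
From mathcomp Require Import all_boot all_order all_algebra.
From mathcomp Require Import ring lra zify.
From mathcomp Require Import Rstruct.
Set Implicit Arguments. Unset Strict Implicit. Unset Printing Implicit Defensive.
Import Order.TTheory GRing.Theory Num.Theory.
Local Open Scope ring_scope.

(** * Block sums over spin configurations *)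

(** Equality holds at [n = 2], and induction goes up from there. With [n = b] and [x = d / b] this
    bounds [1 - (1 - d/b)^b] by [d - d^2/4], the quadratic gain behind the decay at criticality. *)
Lemma pow_one_sub_ge (R : realFieldType) (n : nat) (x : R) :
  (2 <= n)%N -> 0 <= x -> n%:R * x <= 1 ->
  1 - n%:R * x + (n%:R * x) ^+ 2 / 4 <= (1 - x) ^+ n.
Proof.
case: n => [|[|n]] // _ x0; elim: n => [|n IH] nx.
  by rewrite le_eqVlt; apply/orP; left; apply/eqP; rewrite expr2; field.
move: nx IH; rewrite exprS -[n.+3%:R]natr1; set m := n.+2%:R => nx IH.
have m2 : 2 <= m by rewrite ler_nat.
have mx : m * x <= 1 by nra.
have {}IH := IH mx.
have x1 : 0 <= 1 - x by nra.
apply: le_trans (ler_wpM2l x1 IH).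
(* The exact surplus of the induction step, nonnegative because [2 <= m] and [m * x <= 1]. *)
have : 0 <= x ^+ 2 * ((m - 1) / 4 + m * (1 - m * x) / 4).
  apply: mulr_ge0; first exact: sqr_ge0.
  have : 0 <= m * (1 - m * x) by rewrite mulr_ge0; lra.
  lra.
lra.
Qed.

Lemma bernoulli (R : realFieldType) (x : R) n : 0 <= x <= 1 -> 1 - n%:R * x <= (1 - x) ^+ n.
Proof.
move=> /andP [x0 x1]; elim: n => [|n IH]; first by rewrite expr0 mul0r subr0.
rewrite exprS -natr1.
have x1' : 0 <= 1 - x by lra.
have := ler_wpM2l x1' IH.
have : 0 <= n%:R * x ^+ 2 by rewrite mulr_ge0 ?sqr_ge0.
lra.
Qed.

(** * Cauchy-Schwarz and Minkowski inequalities for finite sums *)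

Section FiniteSums.
Variables (R : rcfType) (I : finType) (P : pred I).
Implicit Types F G : I -> R.

Lemma sum_sum_mul F G :
  (\sum_(i | P i) F i) * (\sum_(i | P i) G i)
  = \sum_(i | P i) \sum_(j | P j) F i * G j.
Proof. by rewrite mulr_suml; apply: eq_bigr => i _; rewrite mulr_sumr. Qed.

(** Lagrange's identity: twice the defect is the double sum of the squares of
    [F i * G j - F j * G i]. *)
Lemma cauchy_schwarz F G :
  (\sum_(i | P i) F i * G i) ^+ 2
  <= (\sum_(i | P i) F i ^+ 2) * (\sum_(i | P i) G i ^+ 2).
Proof.
have sq : 0 <= \sum_(i | P i) \sum_(j | P j) (F i * G j - F j * G i) ^+ 2.
  by apply: sumr_ge0 => i _; apply: sumr_ge0 => j _; apply: sqr_ge0.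
have E : \sum_(i | P i) \sum_(j | P j) (F i * G j - F j * G i) ^+ 2
  = (\sum_(i | P i) F i ^+ 2) * (\sum_(i | P i) G i ^+ 2)
  + (\sum_(i | P i) G i ^+ 2) * (\sum_(i | P i) F i ^+ 2)
  - 2 * ((\sum_(i | P i) F i * G i) * (\sum_(i | P i) F i * G i)).
  rewrite !sum_sum_mul mulr_sumr -big_split /= -sumrB; apply: eq_bigr => i _.
  rewrite mulr_sumr -big_split /= -sumrB; apply: eq_bigr => j _; ring.
rewrite E in sq; nra.
Qed.

(** The triangle inequality for the planar vectors [(F i, G i)]: once the squares are expanded into
    double sums, it is Cauchy-Schwarz in the plane for each pair [i, j]. *)
Lemma minkowski_sqrt F G :
  (forall i, 0 <= F i) -> (forall i, 0 <= G i) ->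
  (\sum_(i | P i) F i) ^+ 2 + (\sum_(i | P i) G i) ^+ 2
  <= (\sum_(i | P i) Num.sqrt (F i ^+ 2 + G i ^+ 2)) ^+ 2.
Proof.
move=> F0 G0; rewrite !expr2 !sum_sum_mul -big_split /=.
apply: ler_sum => i _; rewrite -big_split /=; apply: ler_sum => j _.
rewrite -sqrtrM; last by rewrite addr_ge0 ?sqr_ge0.
have S0 : 0 <= F i * F j + G i * G j by rewrite addr_ge0 // mulr_ge0.
rewrite -(ger0_norm S0) -sqrtr_sqr ler_wsqrtr //.
have := sqr_ge0 (F i * G j - F j * G i); lra.
Qed.

End FiniteSums.

(** * Configurations frozen outside a block, and Fubini for their sums *)

Section Blocks.
Variables (R : rcfType) (V : finType).
Local Notation C := {ffun V -> bool}.
Implicit Types (S : {set V}) (s t y : C) (F G f g : C -> R) (v : V).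

Definition agree S s t := [forall u, (u \notin S) ==> (s u == t u)].

Lemma agreeP S s t :
  reflect (forall u, u \notin S -> s u = t u) (agree S s t).
Proof. by apply: (iffP 'forall_implyP) => H u /H /eqP. Qed.

Lemma agree_refl S s : agree S s s. Proof. exact/agreeP. Qed.

Lemma agree_sym S s t : agree S s t = agree S t s.
Proof. by apply/agreeP/agreeP => H u /H. Qed.

Lemma agree_trans S : transitive (agree S).
Proof. by move=> t s y /agreeP H /agreeP K; apply/agreeP => u uS; rewrite H ?K. Qed.

Lemma agree_class S s t : agree S s t -> agree S s =1 agree S t.
Proof.
move=> st y; apply/idP/idP; last exact: agree_trans.
by apply: agree_trans; rewrite agree_sym.
Qed.

Lemma agree_sub S S' s t : S \subset S' -> agree S s t -> agree S' s t.
Proof.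
move=> /subsetP sub /agreeP H; apply/agreeP => u uS; apply: H.
by apply: contra uS; apply: sub.
Qed.

Definition patch S s t : C := [ffun u => if u \in S then s u else t u].

Lemma agree_patch S s t : agree S t (patch S s t).
Proof. by apply/agreeP => u; rewrite ffunE => /negbTE ->. Qed.

Lemma patch_class S s t : agree S s t -> patch S t s = t.
Proof.
by move=> /agreeP H; apply/ffunP => u; rewrite ffunE; case: ifPn => // /H.
Qed.

Definition block_sum S F s : R := \sum_(t | agree S s t) F t.

(** Measurability with respect to the spins outside [S]: the set lists the spins that [F] must not
    read. *)
Definition indep S F := forall s t, agree S s t -> F s = F t.

Lemma indep_sub S S' F : S \subset S' -> indep S' F -> indep S F.
Proof. by move=> sub H s t /(agree_sub sub) /H. Qed.

Lemma eq_block_sum S F G s : F =1 G -> block_sum S F s = block_sum S G s.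
Proof. by move=> FG; apply: eq_bigr => t _. Qed.

(** Overwriting [t] on [S] maps the class of any [s] bijectively onto the class of [t], so sums with
    different frozen spins can be compared term by term. *)
Lemma block_sum_patch S F s t :
  block_sum S F t = \sum_(y | agree S s y) F (patch S y t).
Proof.
rewrite /block_sum (reindex_onto (fun y => patch S y t) (fun y => patch S y s)).
  apply: eq_bigl => y; rewrite agree_patch /=; apply/eqP/idP => [<-|sy].
    by rewrite agree_patch.
  apply/ffunP => u; rewrite !ffunE; case: (boolP (u \in S)) => // uS.
  exact: (agreeP _ _ _ sy).
move=> y /agreeP ty; apply/ffunP => u; rewrite !ffunE.
by case: (boolP (u \in S)) => // /ty.
Qed.

Lemma indep_block_sum S F : indep S (block_sum S F).
Proof. by move=> s t st; apply: eq_bigl; apply: agree_class. Qed.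

Lemma indep_block_sum_of S S' F : indep S' F -> indep S' (block_sum S F).
Proof.
move=> FS s t st; rewrite (block_sum_patch S F s t); apply: eq_bigr => y sy.
apply: FS; rewrite -{1}(patch_class sy); apply/agreeP => u uS.
by rewrite !ffunE; case: ifP => // _; apply: (agreeP _ _ _ st).
Qed.

Lemma block_sumZ S F G s :
  indep S F -> block_sum S (fun t => F t * G t) s = F s * block_sum S G s.
Proof.
by move=> FS; rewrite /block_sum mulr_sumr; apply: eq_bigr => t /FS ->.
Qed.

(** Fubini: a configuration agreeing with [s] off the union is reached through exactly one
    intermediate configuration, which changes [s] on [S] only. *)
Lemma block_sumU S S' F s : [disjoint S & S'] ->
  block_sum (S :|: S') F s = block_sum S (block_sum S' F) s.
Proof.
move=> dis; rewrite /block_sum.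
rewrite (exchange_big_dep (fun y => agree (S :|: S') s y)) /=; last first.
  move=> t y /(agree_sub (subsetUl S S')) st /(agree_sub (subsetUr S S')) ty.
  exact: agree_trans st ty.
apply: eq_bigr => y /agreeP sy; rewrite (big_pred1 (patch S y s)) //= => t.
apply/andP/eqP => [[/agreeP st /agreeP ty]|->].
  apply/ffunP => u; rewrite ffunE; case: ifPn => uS; last by rewrite st.
  by rewrite ty // (disjointFr dis uS).
split; first exact: agree_patch.
apply/agreeP => u uS'; rewrite ffunE; case: ifPn => // uS.
by apply: sy; rewrite inE negb_or uS uS'.
Qed.

Lemma block_sum0 F s : block_sum set0 F s = F s.
Proof.
rewrite /block_sum (big_pred1 s) // => t; apply/idP/eqP => [/agreeP H|->].
  by apply/ffunP => u; rewrite H ?inE.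
exact: agree_refl.
Qed.

Lemma block_sum_adj S F G :
  \sum_s F s * block_sum S G s = \sum_s block_sum S F s * G s.
Proof.
under eq_bigr do rewrite /block_sum mulr_sumr.
rewrite (exchange_big_dep predT) //=; apply: eq_bigr => t _.
by rewrite /block_sum mulr_suml; apply: eq_bigl => s; rewrite agree_sym.
Qed.

Lemma block_sum_gt0 S F s : (forall t, 0 < F t) -> 0 < block_sum S F s.
Proof.
move=> F0; rewrite /block_sum (bigD1 s) ?agree_refl //=.
by rewrite ltr_wpDr ?sumr_ge0 // => t _; apply: ltW.
Qed.

Lemma block_sum_ge0 S F s : (forall t, 0 <= F t) -> 0 <= block_sum S F s.
Proof. by move=> F0; apply: sumr_ge0. Qed.

Definition upd s v (x : bool) : C := [ffun u => if u == v then x else s u].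

Lemma updE s v x : upd s v x v = x. Proof. by rewrite ffunE eqxx. Qed.

Lemma agree_upd1 s v x : agree [set v] s (upd s v x).
Proof. by apply/agreeP => u; rewrite !inE ffunE => /negbTE ->. Qed.

Lemma upd_indep S v x F : indep S F -> indep S (fun s => F (upd s v x)).
Proof.
move=> FS s t /agreeP st; apply: FS; apply/agreeP => u uS; rewrite !ffunE.
by case: ifP => // _; apply: st.
Qed.

Lemma upd_updC s v v' x x' : v != v' ->
  upd (upd s v x) v' x' = upd (upd s v' x') v x.
Proof.
move=> vv; apply/ffunP => u; rewrite !ffunE.
by case: (eqVneq u v') => // ->; rewrite eq_sym (negbTE vv).
Qed.

Lemma block_sum1 v F s :
  block_sum [set v] F s = F (upd s v true) + F (upd s v false).
Proof.
rewrite /block_sum (bigD1 (upd s v true)) ?agree_upd1 //=; congr (_ + _).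
rewrite (big_pred1 (upd s v false)) // => t; apply/andP/eqP => [[/agreeP st ne]|->].
  apply/ffunP => u; rewrite ffunE; case: (eqVneq u v) => [->|uv]; last first.
    by rewrite st // inE.
  case E : (t v) => //; case/eqP: ne; apply/ffunP => w; rewrite ffunE.
  by case: (eqVneq w v) => [->//|wv]; rewrite st // inE.
split; first exact: agree_upd1.
by apply/eqP => /ffunP /(_ v); rewrite !updE.
Qed.

Lemma block_sum_upd S F s v x : v \notin S ->
  block_sum S F (upd s v x) = block_sum S (fun t => F (upd t v x)) s.
Proof.
move=> vS; rewrite (block_sum_patch S F s); apply: eq_bigr => y /agreeP sy.
congr F; apply/ffunP => u; rewrite !ffunE.
case: (eqVneq u v) => [->|uv]; first by rewrite (negbTE vS).
by case: ifPn => // /sy.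
Qed.

(** The head factor is constant on the other blocks, and the product of the other sums is constant
    on the head block, so Fubini splits off one factor at a time. *)
Lemma block_sum_prod (I : eqType) (r : seq I) (S : I -> {set V})
    (F : I -> C -> R) s : uniq r ->
  {in r &, forall i j, i != j -> [disjoint S i & S j] /\ indep (S j) (F i)} ->
  block_sum (\bigcup_(i <- r) S i) (fun t => \prod_(i <- r) F i t) s
  = \prod_(i <- r) block_sum (S i) (F i) s.
Proof.
elim: r => [|i r IH] in s *.
  by move=> _ _; rewrite !big_nil block_sum0 big_nil.
move=> /= /andP [ir ur] H; rewrite !big_cons.
have ij j : j \in r -> i != j by move=> jr; apply: contraNneq ir => ->.
have Hi j : j \in r -> [disjoint S i & S j] /\ indep (S j) (F i).
  by move=> jr; apply: H; rewrite ?inE ?eqxx ?jr ?orbT ?ij.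
have Hj j : j \in r -> indep (S i) (F j).
  move=> jr; apply: (proj2 (H j i _ _ _)); rewrite ?inE ?eqxx ?jr ?orbT //.
  by rewrite eq_sym ij.
have dis : [disjoint S i & \bigcup_(j <- r) S j].
  rewrite disjoint_sym disjoints_subset big_seq.
  elim/big_ind: _ => [|A B HA HB|j jr]; first exact: sub0set.
    by rewrite subUset HA.
  by rewrite -disjoints_subset disjoint_sym; case: (Hi j jr).
rewrite block_sumU //.
have indF : indep (\bigcup_(j <- r) S j) (F i).
  have : {in r, forall j, indep (S j) (F i)} by move=> j /Hi [].
  elim: (r) => [|j r' IHr] Hr; rewrite ?big_nil ?big_cons.
    move=> a a' aa; congr F; apply/ffunP => u; apply: (agreeP _ _ _ aa).
    by rewrite inE.
  move=> a a' /agreeP aa.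
  rewrite (Hr j _ a (patch (S j) a' a)) ?inE ?eqxx ?agree_patch //.
  apply: IHr => [k kr|]; first by apply: Hr; rewrite inE kr orbT.
  apply/agreeP => u uS; rewrite ffunE; case: ifPn => // uj.
  by apply: aa; rewrite inE negb_or uj.
transitivity (block_sum (S i) (fun t =>
   block_sum (\bigcup_(j <- r) S j) (fun y => \prod_(k <- r) F k y) t * F i t) s).
  apply: eq_block_sum => t; rewrite mulrC -block_sumZ //.
  by apply: eq_block_sum => y; rewrite big_cons.
rewrite block_sumZ; last first.
  apply: indep_block_sum_of => a a' aa; rewrite big_seq [RHS]big_seq.
  by apply: eq_bigr => j jr; apply: Hj aa.
rewrite mulrC IH // => j k jr kr jk.
by apply: H => //; rewrite inE ?jr ?kr orbT.
Qed.

End Blocks.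

(** * Conditional expectations *)

Section CondExp.
Variables (R : rcfType) (V : finType) (W : {ffun V -> bool} -> R).
Hypothesis W_gt0 : forall s, 0 < W s.
Local Notation C := {ffun V -> bool}.
Implicit Types (S : {set V}) (s t : C) (F G f g : C -> R).

(** The expectation given the spins outside [S], for the law proportional to [W]; the normalizing
    constant cancels. *)
Definition condexp S f s : R :=
  block_sum S (fun t => W t * f t) s / block_sum S W s.

Definition ip f g : R := \sum_s W s * f s * g s.
Definition sqn f : R := ip f f.

Lemma eq_ip f f' g g' : f =1 f' -> g =1 g' -> ip f g = ip f' g'.
Proof. by move=> ff gg; apply: eq_bigr => s _; rewrite ff gg. Qed.

Lemma eq_sqn f g : f =1 g -> sqn f = sqn g.
Proof. by move=> fg; apply: eq_ip. Qed.

Lemma ipC f g : ip f g = ip g f.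
Proof. by apply: eq_bigr => s _; ring. Qed.

Lemma sqn_ge0 f : 0 <= sqn f.
Proof.
by apply: sumr_ge0 => s _; rewrite -mulrA mulr_ge0 ?sqr_ge0 ?ltW.
Qed.

Lemma sqnB f g : sqn (fun s => f s - g s) = sqn f - 2 * ip f g + sqn g.
Proof.
rewrite /sqn /ip mulr_sumr -sumrB -big_split /=; apply: eq_bigr => s _; ring.
Qed.

Lemma sqnB_le f g : sqn (fun s => f s - g s) <= 2 * sqn f + 2 * sqn g.
Proof.
have := sqn_ge0 (fun s => f s - - g s); rewrite !sqnB.
have -> : ip f (fun s => - g s) = - ip f g.
  by rewrite /ip -sumrN; apply: eq_bigr => s _; ring.
have -> : sqn (fun s => - g s) = sqn g.
  by rewrite /sqn /ip; apply: eq_bigr => s _; ring.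
lra.
Qed.

Lemma block_sumW_neq0 S s : block_sum S W s != 0.
Proof. by rewrite gt_eqF // block_sum_gt0. Qed.

Lemma condexp_indep S f : indep S (condexp S f).
Proof.
move=> s t st; rewrite /condexp (indep_block_sum _ st).
by rewrite [block_sum S W s](indep_block_sum _ st).
Qed.

(** Together with [condexp_indep], this makes [condexp S] the orthogonal projection onto the
    functions that do not read [S]. It rests on the symmetry of [agree], through [block_sum_adj]. *)
Lemma condexp_ip S f g : indep S g -> ip (condexp S f) g = ip f g.
Proof.
move=> gS.
transitivity (\sum_s (W s * g s / block_sum S W s)
                * block_sum S (fun t => W t * f t) s).
  by apply: eq_bigr => s _; rewrite /condexp; ring.
rewrite block_sum_adj; apply: eq_bigr => s _.
have -> : block_sum S (fun t => W t * g t / block_sum S W t) s = g s.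
  transitivity (block_sum S (fun t => (g t / block_sum S W t) * W t) s).
    by apply: eq_block_sum => t; ring.
  rewrite block_sumZ ?divfK ?block_sumW_neq0 // => t t' tt.
  by rewrite (gS _ _ tt) (indep_block_sum _ tt).
by ring.
Qed.

Lemma condexp_ip_self S f : ip f (condexp S f) = sqn (condexp S f).
Proof. by rewrite -(condexp_ip _ (@condexp_indep S f)). Qed.

Lemma sqn_sub_condexp S f :
  sqn (fun s => f s - condexp S f s) = sqn f - sqn (condexp S f).
Proof. by rewrite sqnB condexp_ip_self; ring. Qed.

Lemma sqn_condexp_le S f : sqn (condexp S f) <= sqn f.
Proof. by rewrite -subr_ge0 -sqn_sub_condexp sqn_ge0. Qed.

Lemma condexpB S f g s :
  condexp S (fun t => f t - g t) s = condexp S f s - condexp S g s.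
Proof.
rewrite /condexp -mulrBl; congr (_ / _); rewrite /block_sum -sumrB.
by apply: eq_bigr => t _; ring.
Qed.

Lemma condexp0 f s : condexp set0 f s = f s.
Proof. by rewrite /condexp !block_sum0 mulrAC mulfV ?mul1r // gt_eqF. Qed.

Lemma condexp_orth S f g :
  indep S g -> ip (fun s => f s - condexp S f s) g = 0.
Proof.
move=> gS; apply/eqP; rewrite -(subrr (ip f g)) -{2}(condexp_ip f gS).
by rewrite /ip -sumrB; apply/eqP; apply: eq_bigr => s _; ring.
Qed.

(* [f - E_1 E_2 f] is the orthogonal sum of [f - E_1 f] and [E_1 (f - E_2 f)]. *)
Lemma sqn_sub_condexp2 S1 S2 f :
  sqn (fun s => f s - condexp S1 (condexp S2 f) s)
  <= sqn (fun s => f s - condexp S1 f s) + sqn (fun s => f s - condexp S2 f s).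
Proof.
pose k := condexp S1 (fun t => condexp S2 f t - f t).
rewrite (@eq_sqn _ (fun s => (f s - condexp S1 f s) - k s)); last first.
  by move=> s; rewrite /k condexpB; ring.
rewrite sqnB condexp_orth; last exact: condexp_indep.
rewrite mulr0 subr0 lerD2l (le_trans (sqn_condexp_le _ _)) //.
by rewrite le_eqVlt; apply/orP; left; apply/eqP; apply: eq_bigr => s _; ring.
Qed.

Section Factor.
Variables (S S' : {set V}) (F G : C -> R).
Hypotheses (W_FG : forall s, W s = F s * G s) (FS' : indep S' F) (GS : indep S G).

Let F_neq0 s : F s != 0.
Proof. by have := W_gt0 s; rewrite W_FG; apply: contraTneq => ->; rewrite mul0r ltxx. Qed.

(** The factor [F] is constant on the classes of [S'] and cancels between numerator and
    denominator. *)
Lemma condexp_factor f s :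
  condexp S' f s = block_sum S' (fun t => G t * f t) s / block_sum S' G s.
Proof.
rewrite /condexp -(mulKf (F_neq0 s) (block_sum S' G s)) -block_sumZ //.
rewrite -[block_sum S' (fun t => G t * f t) s](mulKf (F_neq0 s)) -block_sumZ //.
rewrite invfM invrK mulrACA mulVf // mul1r; congr (_ / _).
  by apply: eq_block_sum => t; rewrite W_FG mulrA.
exact: eq_block_sum.
Qed.

Lemma condexp_indep_of S0 f : indep S0 G -> indep S0 f -> indep S0 (condexp S' f).
Proof.
move=> GS0 fS0 s t st; rewrite !condexp_factor.
have GfS0 : indep S0 (fun y => G y * f y).
  by move=> a b ab; rewrite (GS0 _ _ ab) (fS0 _ _ ab).
by congr (_ / _); apply: indep_block_sum_of st.
Qed.

End Factor.

(** The factorization makes the spins on [S] and on [S'] independent given all the others, so a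
    joint average is an iterated one. *)
Lemma condexpU S S' F G f s :
  [disjoint S & S'] -> (forall s, W s = F s * G s) -> indep S' F -> indep S G ->
  condexp (S :|: S') f s = condexp S (condexp S' f) s.
Proof.
move=> dis WFG FS' GS.
have WGF t : W t = G t * F t by rewrite WFG mulrC.
have F0 t : F t != 0.
  by have := W_gt0 t; rewrite WFG; apply: contraTneq => ->; rewrite mul0r ltxx.
rewrite (condexp_factor WGF GS).
have IG : indep S (block_sum S' G) by apply: indep_block_sum_of.
have -> : block_sum S (fun t => F t * condexp S' f t) s
   = (block_sum S' G s)^-1
     * block_sum S (block_sum S' (fun t => W t * f t)) s.
  transitivity (block_sum S (fun t => (block_sum S' G t)^-1
      * block_sum S' (fun y => W y * f y) t) s); last first.
    by apply: block_sumZ => a b ab; rewrite (IG _ _ ab).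
  apply: eq_block_sum => t; rewrite (condexp_factor WFG FS') mulrA mulrC.
  congr (_ * _); rewrite -block_sumZ //; apply: eq_block_sum => y.
  by rewrite WFG mulrA.
rewrite /condexp block_sumU // mulrAC mulrC; congr (_ * _).
rewrite block_sumU // -invfM; congr (_^-1); rewrite -block_sumZ //.
apply: eq_block_sum => t; rewrite mulrC -block_sumZ //.
exact: eq_block_sum.
Qed.

(* This is [|(1 - E_1)(1 - E_2) g|^2 >= 0], expanded for commuting projections. *)
Lemma sqn_condexp_commute S S' g :
  (forall s, condexp S (condexp S' g) s = condexp S' (condexp S g) s) ->
  sqn (condexp S g) + sqn (condexp S' g)
  <= sqn g + sqn (condexp S (condexp S' g)).
Proof.
move=> comm.
have := sqn_condexp_le S (fun s => g s - condexp S' g s).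
have -> : sqn (condexp S (fun s => g s - condexp S' g s))
   = sqn (condexp S g) - sqn (condexp S' (condexp S g)).
  by rewrite -sqn_sub_condexp; apply: eq_sqn => s; rewrite condexpB comm.
rewrite sqn_sub_condexp (eq_sqn comm); lra.
Qed.

(** Tensorization without loss in [c]: bounding both terms of the first inequality by the other two
    leaves [c * (1 - c)] times the squared norms of [condexp T1 g] and [condexp T2 g], and
    [sqn_condexp_commute] absorbs these cross terms. *)
Lemma sqn_condexp_tensor S1 T1 S2 T2 (c : R) g : 0 <= c <= 1 ->
  (forall s, condexp T1 (condexp S2 g) s = condexp S2 (condexp T1 g) s) ->
  (forall s, condexp T1 (condexp T2 g) s = condexp T2 (condexp T1 g) s) ->
  sqn (condexp S1 (condexp S2 g))
    <= (1 - c) * sqn (condexp S2 g) + c * sqn (condexp T1 (condexp S2 g)) ->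
  sqn (condexp S2 g) <= (1 - c) * sqn g + c * sqn (condexp T2 g) ->
  sqn (condexp S2 (condexp T1 g))
    <= (1 - c) * sqn (condexp T1 g) + c * sqn (condexp T2 (condexp T1 g)) ->
  sqn (condexp S1 (condexp S2 g))
    <= (1 - c) * sqn g + c * sqn (condexp T1 (condexp T2 g)).
Proof.
move=> /andP [c0 c1] comm comm' H1 H2 H3.
have := sqn_condexp_commute comm'.
rewrite (eq_sqn comm') (eq_sqn comm) in H1 * => K.
have c1' : 0 <= 1 - c by rewrite subr_ge0.
have := ler_wpM2l c1' H2; have := ler_wpM2l c0 H3.
have := ler_wpM2l (mulr_ge0 c0 c1') K; lra.
Qed.

End CondExp.

(** * Hellinger affinity and maximal correlation for a binary variable *)

Section TwoPoint.
Variables (R : rcfType) (I : finType) (P : pred I).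

Lemma weighted_cauchy_schwarz (M F G : I -> R) : (forall i, 0 < M i) ->
  (\sum_(i | P i) F i * G i) ^+ 2
  <= (\sum_(i | P i) F i ^+ 2 * M i) * (\sum_(i | P i) G i ^+ 2 / M i).
Proof.
move=> M0.
have S0 i : Num.sqrt (M i) != 0 by rewrite gt_eqF // sqrtr_gt0.
have SS i : Num.sqrt (M i) ^+ 2 = M i by rewrite sqr_sqrtr // ltW.
have := cauchy_schwarz P (fun i => F i * Num.sqrt (M i)) (fun i => G i / Num.sqrt (M i)).
rewrite (eq_bigr (fun i => F i * G i)); last by move=> i _; field.
rewrite [X in _ <= X * _](eq_bigr (fun i => F i ^+ 2 * M i)); last by move=> i _; rewrite exprMn SS.
rewrite [X in _ <= _ * X](eq_bigr (fun i => G i ^+ 2 / M i)) //.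
by move=> i _; rewrite expr_div_n SS.
Qed.

(* A binary variable with prior weights [r1], [r2] is observed through the laws
   [m1], [m2]: the squared Hellinger affinity bounds the maximal correlation,
   whatever the prior. *)
Lemma hellinger_variance (m1 m2 g : I -> R) (r1 r2 d : R) (i0 : I) : P i0 ->
  (forall i, 0 < m1 i) -> (forall i, 0 < m2 i) -> 0 < r1 -> 0 < r2 ->
  let Z1 := \sum_(i | P i) m1 i in
  let Z2 := \sum_(i | P i) m2 i in
  let a1 := \sum_(i | P i) g i * m1 i in
  let a2 := \sum_(i | P i) g i * m2 i in
  let q1 := \sum_(i | P i) g i ^+ 2 * m1 i in
  let q2 := \sum_(i | P i) g i ^+ 2 * m2 i in
  (1 - d) * (Z1 * Z2) <= (\sum_(i | P i) Num.sqrt (m1 i * m2 i)) ^+ 2 ->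
  r1 * (a1 ^+ 2 / Z1) + r2 * (a2 ^+ 2 / Z2)
  <= d * (r1 * q1 + r2 * q2)
     + (1 - d) * ((r1 * a1 + r2 * a2) ^+ 2 / (r1 * Z1 + r2 * Z2)).
Proof.
move=> Pi0 m1p m2p r1p r2p Z1 Z2 a1 a2 q1 q2 hell.
have sum_pos (m : I -> R) : (forall i, 0 < m i) -> 0 < \sum_(i | P i) m i.
  move=> mp; rewrite (bigD1 i0) //= ltr_wpDr ?mp // sumr_ge0 // => i _.
  exact: ltW.
have Z1p : 0 < Z1 by apply: sum_pos.
have Z2p : 0 < Z2 by apply: sum_pos.
pose M i := r1 * m1 i + r2 * m2 i.
have Mp i : 0 < M i by rewrite addr_gt0 // mulr_gt0.
pose N := r1 * Z1 + r2 * Z2.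
have Np : 0 < N by rewrite addr_gt0 // mulr_gt0.
have MN : \sum_(i | P i) M i = N by rewrite big_split /= -!mulr_sumr.
(* [gb] is the overall mean of [g], [X / (Z1 * Z2)] the difference of its two conditional means, and
   [Vr / N] its variance. Since [G] sums to zero, [g] may be centred at [gb] inside [X]. *)
pose gb := (r1 * a1 + r2 * a2) / N.
pose X := a1 * Z2 - a2 * Z1.
pose G i := m1 i * Z2 - m2 i * Z1.
pose K := \sum_(i | P i) m1 i * m2 i / M i.
pose Vr := \sum_(i | P i) (g i - gb) ^+ 2 * M i.
have XE : X = \sum_(i | P i) (g i - gb) * G i.
  have -> : \sum_(i | P i) (g i - gb) * G i
      = a1 * Z2 - a2 * Z1 - gb * (Z1 * Z2 - Z2 * Z1).
    rewrite !mulr_suml -!sumrB mulr_sumr -sumrB; apply: eq_bigr => i _.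
    by rewrite /G; ring.
  by rewrite /X; ring.
have VE : Vr = r1 * q1 + r2 * q2 - (r1 * a1 + r2 * a2) ^+ 2 / N.
  transitivity (r1 * q1 + r2 * q2 - 2 * gb * (r1 * a1 + r2 * a2) + gb ^+ 2 * N).
    rewrite -MN /q1 /q2 /a1 /a2 !mulr_sumr -!big_split /= mulr_sumr -sumrB.
    by rewrite -big_split /=; apply: eq_bigr => i _; rewrite /M; ring.
  by rewrite /gb; field; rewrite gt_eqF.
have GE : r1 * r2 * \sum_(i | P i) G i ^+ 2 / M i = Z1 * Z2 * N - N ^+ 2 * K.
  transitivity (r2 * Z2 ^+ 2 * (\sum_(i | P i) m1 i)
     + r1 * Z1 ^+ 2 * (\sum_(i | P i) m2 i) - N ^+ 2 * K); last first.
    by rewrite -/Z1 -/Z2 /N; ring.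
  rewrite /K !mulr_sumr -big_split -sumrB /=.
  apply: eq_bigr => i _; rewrite /N /G.
  have : M i != 0 by rewrite gt_eqF.
  by rewrite /M => Mi; field.
(* Weighted Cauchy-Schwarz bounds the squared affinity by [N * K], so a large affinity makes the sum
   evaluated in [GE] small. *)
have KE : (1 - d) * (Z1 * Z2) <= N * K.
  apply: (le_trans hell).
  have := weighted_cauchy_schwarz (fun=> 1) (fun i => Num.sqrt (m1 i * m2 i)) Mp.
  rewrite (eq_bigr (fun i => Num.sqrt (m1 i * m2 i))) => [|i _]; last by rewrite mul1r.
  rewrite [X in _ <= X * _](eq_bigr M) => [|i _]; last by rewrite expr1n mul1r.
  rewrite MN [X in _ <= N * X](eq_bigr (fun i => m1 i * m2 i / M i)) // => i _.
  by rewrite sqr_sqrtr // mulr_ge0 // ltW.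
have XV : r1 * r2 * X ^+ 2 <= Vr * (d * (Z1 * Z2) * N).
  have cs : X ^+ 2 <= Vr * \sum_(i | P i) G i ^+ 2 / M i.
    by rewrite XE; apply: weighted_cauchy_schwarz.
  have rp : 0 <= r1 * r2 by rewrite mulr_ge0 // ltW.
  apply: (le_trans (ler_wpM2l rp cs)).
  rewrite mulrCA GE; apply: ler_wpM2l.
    by apply: sumr_ge0 => i _; rewrite mulr_ge0 ?sqr_ge0 // ltW.
  have := ler_wpM2l (ltW Np) KE; lra.
(* [N] times the variance of the conditional mean of [g] given the binary variable. *)
have bet : r1 * (a1 ^+ 2 / Z1) + r2 * (a2 ^+ 2 / Z2) - (r1 * a1 + r2 * a2) ^+ 2 / N
   = r1 * r2 * X ^+ 2 / (Z1 * Z2 * N).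
  have : N != 0 by rewrite gt_eqF.
  by rewrite /N /X => N0; field; rewrite N0 !gt_eqF.
have : r1 * r2 * X ^+ 2 / (Z1 * Z2 * N) <= d * Vr.
  rewrite ler_pdivrMr ?mulr_gt0 //; lra.
rewrite -bet VE; lra.
Qed.

End TwoPoint.

(** * The Ising model on a tree *)

(* [childof c v]: [c] is a child of [v]; [below u v]: [u] is [v] or a
   descendant of [v]. *)
Record tree (V : finType) (b : nat) := Tree {
  lev : V -> nat;
  childof : rel V;
  below : rel V;
  below_refl : forall v, below v v;
  lev_child : forall c v, childof c v -> lev c = (lev v).+1;
  lev_below : forall u v, below u v -> (lev v <= lev u)%N;
  below_child : forall u c v, childof c v -> below u c -> below u v;
  child_below : forall u p v, childof u p -> below p v -> below u v;
  below_inv : forall u v, below u v -> u = v \/ exists2 c, childof c v & below u c;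
  below_inj : forall u v v', below u v -> below u v' -> lev v = lev v' -> v = v';
  card_child : forall v, (#|[set c | childof c v]| <= b)%N
}.

Section TreeIsing.
Variables (R : rcfType) (V : finType) (b : nat) (T : tree V b) (a : R).
Hypothesis a_ge1 : 1 <= a.
Local Notation C := {ffun V -> bool}.
Local Notation lev := (lev T).
Local Notation childof := (childof T).
Local Notation below := (below T).
Implicit Types (S X L : {set V}) (s t y : C) (u v p c : V) (U : seq V).

Definition bond (x y : bool) : R := if x == y then a else a^-1.

(** Each edge is charged to its lower endpoint, so [bonds] is multiplicative over disjoint vertex
    sets; a vertex without parent contributes the empty product. *)
Definition bonds X s : R := \prod_(u in X) \prod_(p | childof u p) bond (s u) (s p).

Definition ising s : R := bonds setT s.

Definition subtree v := [set u | below u v].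
Definition offspring v := subtree v :\ v.
Definition children v := enum [set c | childof c v].

Lemma a_gt0 : 0 < a. Proof. exact: lt_le_trans ltr01 a_ge1. Qed.

Lemma bonds_gt0 X s : 0 < bonds X s.
Proof.
apply: prodr_gt0 => u _; apply: prodr_gt0 => p _; rewrite /bond.
by case: ifP => _; rewrite ?invr_gt0 a_gt0.
Qed.

Lemma ising_gt0 s : 0 < ising s. Proof. exact: bonds_gt0. Qed.

Lemma ising_split X s : ising s = bonds X s * bonds (~: X) s.
Proof.
rewrite /ising /bonds (big_setID X) /= setTI setTD; congr (_ * _).
Qed.

Lemma bondsU X X' s : [disjoint X & X'] ->
  bonds (X :|: X') s = bonds X s * bonds X' s.
Proof. by move=> dis; rewrite /bonds -bigU //; apply: eq_bigl => u; rewrite !inE. Qed.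

Definition closed_below S := forall u p, childof u p -> p \in S -> u \in S.

(** An edge charged to a vertex outside [S] has both ends outside: were the parent in [S], so would
    be the child. *)
Lemma bonds_indep S X : closed_below S -> [disjoint X & S] -> indep S (bonds X).
Proof.
move=> clS dis s t /agreeP st; apply: eq_bigr => u uX; apply: eq_bigr => p up.
have uS : u \notin S by rewrite (disjointFr dis uX).
by rewrite !st //; apply: contra uS => /(clS _ _ up).
Qed.

Lemma closed_subtree v : closed_below (subtree v).
Proof. by move=> u p up; rewrite !inE; apply: child_below. Qed.

Lemma closed_bigcup U : closed_below (\bigcup_(u <- U) subtree u).
Proof.
elim: U => [|u U IH]; first by rewrite big_nil => w p _; rewrite inE.
rewrite big_cons => w p wp; rewrite !inE => /orP [|/(IH _ _ wp) ->]; last first.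
  by rewrite orbT.
by move=> /(child_below wp) ->.
Qed.

Lemma below_offspring u v : u \in offspring v -> (lev v < lev u)%N.
Proof.
rewrite !inE => /andP [uv /below_inv [uv'|[c cv uc]]]; first by rewrite uv' eqxx in uv.
by rewrite -(lev_child cv) (lev_below uc).
Qed.

Lemma closed_offspring v : closed_below (offspring v).
Proof.
move=> u p up pv; have lt := below_offspring pv.
move: pv; rewrite !inE => /andP [_ pv]; rewrite (child_below up pv) andbT.
by apply: contraTneq lt => <-; rewrite (lev_child up) -leqNgt.
Qed.

Lemma child_uniq u p p' : childof u p -> childof u p' -> p' = p.
Proof.
move=> up up'; apply: (@below_inj _ _ T u).
- exact: below_child up' (below_refl _ _).
- exact: below_child up (below_refl _ _).
by have := lev_child up; rewrite (lev_child up') => -[].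
Qed.

Lemma child_neq v p : childof v p -> p != v.
Proof. by move=> /lev_child lv; apply/eqP => pv; rewrite pv in lv; lia. Qed.

Lemma mem_children c v : (c \in children v) = childof c v.
Proof. by rewrite mem_enum inE. Qed.

Lemma uniq_children v : uniq (children v). Proof. exact: enum_uniq. Qed.

Lemma size_children v : (size (children v) <= b)%N.
Proof. by rewrite -cardE card_child. Qed.

Lemma mem_bigcup_seq (U : seq V) (S : V -> {set V}) x :
  (x \in \bigcup_(u <- U) S u) = has (fun u => x \in S u) U.
Proof.
by elim: U => [|u U IH] /=; rewrite ?big_nil ?big_cons ?inE //= IH.
Qed.

Lemma bigcup_setI U (S : V -> {set V}) L :
  (\bigcup_(u <- U) S u) :&: L = \bigcup_(u <- U) (S u :&: L).
Proof. exact: (big_morph (fun A => A :&: L) (fun A B => setIUl A B L) (set0I L)). Qed.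

Lemma offspring_bigcup v : offspring v = \bigcup_(c <- children v) subtree c.
Proof.
apply/setP => u; rewrite mem_bigcup_seq; apply/idP/hasP => [uv|[c]].
  have lt := below_offspring uv; move: uv; rewrite !inE => /andP [_ /below_inv].
  case=> [uv|[c cv uc]]; first by rewrite uv ltnn in lt.
  by exists c; rewrite ?mem_children ?inE.
rewrite mem_children !inE => cv uc; rewrite (below_child cv uc) andbT.
apply: contraTneq (lev_below uc) => ->.
by rewrite (lev_child cv) ltnn.
Qed.

Lemma subtreeE v : subtree v = v |: offspring v.
Proof. by rewrite setD1K // inE below_refl. Qed.

Lemma subtree_disjoint u u' : lev u = lev u' -> u != u' ->
  [disjoint subtree u & subtree u'].
Proof.
move=> ll ne; rewrite disjoints_subset; apply/subsetP => x; rewrite !inE => xu.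
by apply: contra ne => xu'; rewrite (below_inj xu xu' ll).
Qed.

(** * Conditional independence of subtrees rooted at one level *)

Definition same_level k U := uniq U && all (fun u => lev u == k) U.

Lemma same_level_children v : same_level (lev v).+1 (children v).
Proof.
rewrite /same_level uniq_children; apply/allP => c.
by rewrite mem_children => /lev_child ->.
Qed.

Lemma subtree_disjoint_bigcup k u U : same_level k (u :: U) ->
  [disjoint subtree u & \bigcup_(u' <- U) subtree u'].
Proof.
move=> /andP /= [/andP [uU _] /andP [/eqP lu /allP lU]].
rewrite disjoints_subset; apply/subsetP => x xu.
rewrite inE mem_bigcup_seq; apply/hasPn => u' u'U.
rewrite (disjointFr (subtree_disjoint _ _) xu) //.
  by rewrite lu (eqP (lU _ u'U)).
by apply: contraNneq uU => ->.
Qed.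

Lemma same_level_tail k u U : same_level k (u :: U) -> same_level k U.
Proof. by move=> /andP /= [/andP [_ uU] /andP [_ lU]]; apply/andP. Qed.

Local Notation E := (condexp ising).
Local Notation nrm := (sqn ising).
Let Wp := ising_gt0.

(** Markov property: the edges charged to [subtree u] avoid the other subtrees, and all remaining
    edges avoid [subtree u]. *)
Lemma condexp_siblings k u U S S' (f : C -> R) s : same_level k (u :: U) ->
  S \subset subtree u -> S' \subset \bigcup_(u' <- U) subtree u' ->
  E (S :|: S') f s = E S (E S' f) s /\ E (S :|: S') f s = E S' (E S f) s.
Proof.
move=> lev sS sS'; have dis := subtree_disjoint_bigcup lev.
have iF : indep S' (bonds (subtree u)).
  by apply: indep_sub sS' _; apply: bonds_indep dis; apply: closed_bigcup.
have iG : indep S (bonds (~: subtree u)).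
  apply: indep_sub sS _; apply: bonds_indep (@closed_subtree u) _.
  by rewrite disjoints_subset.
have dSS : [disjoint S & S'] by apply: disjointWl sS _; apply: disjointWr sS' _.
split; first exact: (condexpU Wp _ _ dSS (ising_split (subtree u))).
rewrite setUC; apply: (condexpU Wp (F := bonds (~: subtree u))
  (G := bonds (subtree u))) => //; first by rewrite disjoint_sym.
by move=> t; rewrite (ising_split (subtree u)) mulrC.
Qed.

Lemma condexp_siblings_indep k u U S S' (f : C -> R) : same_level k (u :: U) ->
  S \subset subtree u -> S' \subset \bigcup_(u' <- U) subtree u' ->
  (indep S f -> indep S (E S' f)) /\ (indep S' f -> indep S' (E S f)).
Proof.
move=> lev sS sS'; have dis := subtree_disjoint_bigcup lev.
have iF : indep S' (bonds (subtree u)).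
  by apply: indep_sub sS' _; apply: bonds_indep dis; apply: closed_bigcup.
have iG : indep S (bonds (~: subtree u)).
  apply: indep_sub sS _; apply: bonds_indep (@closed_subtree u) _.
  by rewrite disjoints_subset.
split; first exact: (condexp_indep_of Wp (ising_split (subtree u))).
apply: (condexp_indep_of Wp (F := bonds (~: subtree u)) (G := bonds (subtree u))) => //.
by move=> t; rewrite (ising_split (subtree u)) mulrC.
Qed.

(** Maximal correlation does not grow over independent subtrees, so [c] stays the same. The
    hypothesis ranges over all functions not reading [L0] in the subtree because the induction
    applies it to conditional expectations of [g]. *)
Lemma sqn_siblings (c : R) k U L0 L1 L2 : 0 <= c <= 1 -> same_level k U ->
  (forall u g, u \in U -> indep (subtree u :&: L0) g ->
     nrm (E (subtree u :&: L1) g)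
     <= (1 - c) * nrm g + c * nrm (E (subtree u :&: L2) g)) ->
  forall g, indep (\bigcup_(u <- U) subtree u :&: L0) g ->
    nrm (E (\bigcup_(u <- U) subtree u :&: L1) g)
    <= (1 - c) * nrm g + c * nrm (E (\bigcup_(u <- U) subtree u :&: L2) g).
Proof.
move=> c01; elim: U => [|u U IH] sl H g gi.
  rewrite !big_nil !set0I !(eq_sqn _ (condexp0 Wp g)); lra.
rewrite !big_cons !setIUl in gi *.
have sl' := same_level_tail sl.
have {}IH := IH sl' (fun v g vU => H v g (mem_behead (s := u :: U) vU)).
set D := \bigcup_(j <- U) subtree j in gi IH *.
have sub L : subtree u :&: L \subset subtree u by apply: subsetIl.
have sub' L : D :&: L \subset D by apply: subsetIl.
have giu : indep (subtree u :&: L0) g by apply: indep_sub gi; apply: subsetUl.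
have giU : indep (D :&: L0) g by apply: indep_sub gi; apply: subsetUr.
have EU L L' s := condexp_siblings g s sl (sub L) (sub' L').
rewrite (eq_sqn _ (fun s => proj1 (EU L1 L1 s))).
rewrite (eq_sqn _ (fun s => proj1 (EU L2 L2 s))).
apply: sqn_condexp_tensor => //.
- by move=> s; case: (EU L2 L1 s) => <-.
- by move=> s; case: (EU L2 L2 s) => <-.
- apply: H; first exact: mem_head.
  exact: (proj1 (condexp_siblings_indep g sl (sub L0) (sub' L1))).
- exact: IH.
apply: IH.
exact: (proj2 (condexp_siblings_indep g sl (sub L2) (sub' L0))).
Qed.

(** The Efron-Stein inequality, obtained by iterating [sqn_sub_condexp2]. *)
Lemma efron_stein_siblings k U L f : same_level k U ->
  nrm (fun s => f s - E (\bigcup_(u <- U) subtree u :&: L) f s)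
  <= \sum_(u <- U) nrm (fun s => f s - E (subtree u :&: L) f s).
Proof.
elim: U => [|u U IH] sl.
  rewrite !big_nil set0I le_eqVlt; apply/orP; left; apply/eqP.
  by rewrite /sqn /ip big1 // => s _; rewrite condexp0 // subrr mulr0.
rewrite !big_cons setIUl.
rewrite (eq_sqn _ (g := fun s => f s - E (subtree u :&: L)
   (E (\bigcup_(j <- U) subtree j :&: L) f) s)); last first.
  move=> s; congr (_ - _).
  by case: (condexp_siblings f s sl (subsetIl _ L) (subsetIl _ L)).
apply: (le_trans (sqn_sub_condexp2 Wp _ _ _)); rewrite lerD2l.
exact: IH (same_level_tail sl).
Qed.

Definition hellinger S v (F : C -> R) (d : R) := forall s,
  (1 - d) * (block_sum S (fun y => F (upd y v true)) s
             * block_sum S (fun y => F (upd y v false)) s)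
  <= (block_sum S (fun y => Num.sqrt (F (upd y v true) * F (upd y v false))) s) ^+ 2.

Lemma hellinger_le S v F d d' : (forall s, 0 <= F s) -> d <= d' ->
  hellinger S v F d -> hellinger S v F d'.
Proof.
move=> F0 dd H s; apply: le_trans (H s); apply: ler_wpM2r; last by rewrite lerD2l lerN2.
by rewrite mulr_ge0 ?block_sum_ge0.
Qed.

Lemma hellinger1 S v F : hellinger S v F 1.
Proof. by move=> s; rewrite subrr mul0r sqr_ge0. Qed.

(** * Affinity along the tree: product over children, contraction along an edge *)

Section Hellinger.
Variables (L B : {set V}).

(* After summing out the levels [L], these are, up to normalization, the laws of
   the rest of the subtree of [v] given the spin of the parent of [v], resp. given
   the spin of [v] itself; both spins are read off [s]. *)
Definition down_marginal v s : R := block_sum (subtree v :&: L) (bonds (subtree v)) s.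
Definition root_marginal v s : R :=
  block_sum (offspring v :&: L) (bonds (offspring v)) s.

Lemma down_marginal_gt0 v s : 0 < down_marginal v s.
Proof. by apply: block_sum_gt0 => t; apply: bonds_gt0. Qed.

Lemma root_marginal_gt0 v s : 0 < root_marginal v s.
Proof. by apply: block_sum_gt0 => t; apply: bonds_gt0. Qed.

Lemma bonds_bigcup k U s : same_level k U ->
  bonds (\bigcup_(u <- U) subtree u) s = \prod_(u <- U) bonds (subtree u) s.
Proof.
elim: U => [|u U IH] sl; first by rewrite !big_nil /bonds big_set0.
rewrite !big_cons -(IH (same_level_tail sl)) /bonds.
exact: bondsU (subtree_disjoint_bigcup sl).
Qed.

Lemma siblings_indep v : {in children v &, forall c c', c != c' ->
  forall S S', [disjoint subtree c :&: S & subtree c' :&: S']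
    /\ indep (subtree c' :&: S') (bonds (subtree c))}.
Proof.
move=> c c'; rewrite !mem_children => cv cv' ne S S'.
have dis : [disjoint subtree c & subtree c'].
  by apply: subtree_disjoint ne; rewrite (lev_child cv) (lev_child cv').
split; first by apply: disjointWl (subsetIl _ _) _; apply: disjointWr (subsetIl _ _) _.
apply: indep_sub (subsetIl _ _) _.
exact: bonds_indep (@closed_subtree c') dis.
Qed.

Lemma root_marginal_prod v s :
  root_marginal v s = \prod_(c <- children v) down_marginal c s.
Proof.
rewrite /root_marginal offspring_bigcup bigcup_setI -block_sum_prod ?uniq_children //.
  by apply: eq_block_sum => t; apply: bonds_bigcup (same_level_children v).
by move=> c c' cv cv' ne; apply: (siblings_indep cv cv' ne).
Qed.

(** A vertex may have fewer than [b] children; each missing factor [1 - e] is at most one. *)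
Lemma prod_children_ge (F : V -> R) (e : R) v : 0 <= e <= 1 ->
  (forall c, 0 <= F c) ->
  (1 - e) ^+ b * (\prod_(c <- children v) F c)
  <= \prod_(c <- children v) ((1 - e) * F c).
Proof.
move=> /andP [e0 e1] F0; rewrite big_split /=.
apply: ler_wpM2r; first by apply: prodr_ge0.
have -> : \prod_(c <- children v) (1 - e) = (1 - e) ^+ size (children v).
  by elim: (children v) => [|c U IH]; rewrite ?big_nil // big_cons IH exprS.
by apply: ler_wiXn2l; rewrite ?size_children // ?subr_ge0 // gerBl.
Qed.

(** Given the spin of [v], the subtrees of its children are independent: the two masses and the
    affinity factor over at most [b] children, each with squared affinity at least [1 - e]. *)
Lemma hellinger_root v e : 0 <= e <= 1 ->
  (forall c, childof c v -> hellinger (subtree c :&: B) v (down_marginal c) e) ->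
  hellinger (offspring v :&: B) v (root_marginal v) (1 - (1 - e) ^+ b).
Proof.
move=> e01 H s; rewrite subKr.
have split_sum (F : V -> C -> R) :
    (forall c S', indep S' (bonds (subtree c)) -> indep S' (F c)) ->
    block_sum (offspring v :&: B) (fun y => \prod_(c <- children v) F c y) s
    = \prod_(c <- children v) block_sum (subtree c :&: B) (F c) s.
  move=> Fi; rewrite offspring_bigcup bigcup_setI block_sum_prod ?uniq_children //.
  move=> c c' cv cv' ne; case: (siblings_indep cv cv' ne B B) => dis ind.
  by split=> //; apply: Fi.
have ind_upd x c S' : indep S' (bonds (subtree c)) ->
    indep S' (fun y => down_marginal c (upd y v x)).
  by move=> ind; apply: upd_indep; apply: indep_block_sum_of.
have sum_x x : block_sum (offspring v :&: B) (fun y => root_marginal v (upd y v x)) s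
    = \prod_(c <- children v)
        block_sum (subtree c :&: B) (fun y => down_marginal c (upd y v x)) s.
  rewrite -split_sum; last by move=> c S'; apply: ind_upd.
  by apply: eq_block_sum => y; rewrite root_marginal_prod.
have sum_sqrt : block_sum (offspring v :&: B)
    (fun y => Num.sqrt (root_marginal v (upd y v true) * root_marginal v (upd y v false))) s
    = \prod_(c <- children v) block_sum (subtree c :&: B) (fun y =>
        Num.sqrt (down_marginal c (upd y v true) * down_marginal c (upd y v false))) s.
  rewrite -split_sum; last first.
    move=> c S' ind y y' yy.
    by rewrite (ind_upd true _ _ ind _ _ yy) (ind_upd false _ _ ind _ _ yy).
  apply: eq_block_sum => y; rewrite !root_marginal_prod -big_split /=.
  elim: (children v) => [|c U IH]; first by rewrite !big_nil sqrtr1.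
  rewrite !big_cons -IH -sqrtrM //.
  by rewrite mulr_ge0 // ltW // down_marginal_gt0.
rewrite !sum_x sum_sqrt -big_split /= -prodrXl.
apply: (le_trans (prod_children_ge v e01 _)).
  by move=> c; rewrite mulr_ge0 // block_sum_ge0 // => t; rewrite ltW ?down_marginal_gt0.
rewrite big_seq [leRHS]big_seq; apply: ler_prod => c; rewrite mem_children => cv.
rewrite H // andbT mulr_ge0 ?subr_ge0 ?(andP e01).2 //.
by rewrite mulr_ge0 // block_sum_ge0 // => t; rewrite ltW ?down_marginal_gt0.
Qed.

Lemma bonds1 v p s : childof v p -> bonds [set v] s = bond (s v) (s p).
Proof.
move=> vp; rewrite /bonds big_set1 (big_pred1 p) // => p'.
by apply/idP/eqP => [/(child_uniq vp)|->].
Qed.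

(** As [v] lies in [L], its spin is summed out too; it enters through the edge to [p] and as the
    conditioning spin of [root_marginal]. *)
Lemma down_marginalE v p s : childof v p -> v \in L ->
  down_marginal v s = bond true (s p) * root_marginal v (upd s v true)
                    + bond false (s p) * root_marginal v (upd s v false).
Proof.
move=> vp vL; rewrite /down_marginal.
have -> : subtree v :&: L = [set v] :|: (offspring v :&: L).
  by rewrite {1}subtreeE setIUl; congr (_ :|: _); apply/setIidPl; rewrite sub1set.
rewrite block_sumU; last by rewrite disjoints1 !inE eqxx.
have pv := child_neq vp.
transitivity (block_sum [set v] (fun t => bond (t v) (t p) * root_marginal v t) s).
  apply: eq_block_sum => t; rewrite -(bonds1 _ vp) /root_marginal -block_sumZ.
    apply: eq_block_sum => y; rewrite subtreeE bondsU //.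
    by rewrite disjoints1 !inE eqxx.
  apply: indep_sub (subsetIl _ _) _; apply: bonds_indep (@closed_offspring v) _.
  by rewrite disjoints1 !inE eqxx.
by rewrite block_sum1 !updE !ffunE (negbTE pv).
Qed.

Lemma root_marginal_parent v p s x : childof v p ->
  root_marginal v (upd s p x) = root_marginal v s.
Proof.
move=> vp; apply/esym; apply: (@indep_block_sum_of _ _ _ [set p]) (agree_upd1 _ _ _).
move=> y y' /agreeP yy; apply: eq_bigr => u uv; apply: eq_bigr => p' up'.
have lu := below_offspring uv; have lv := lev_child vp; have lp := lev_child up'.
by rewrite !yy // inE; apply: contraTneq lu => ?; subst; lia.
Qed.

(* With [a * a^-1 = 1], the channel turns the pair of laws [(m, m')] into
   [n = a m + a^-1 m'] and [n' = a^-1 m + a m'], for which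
   [n n' = (m + m')^2 + (a - a^-1)^2 m m'] and Minkowski's inequality applies. *)
Lemma hellinger_channel v p (d t : R) : childof v p -> v \in L -> v \notin B -> 0 <= d ->
  (a - a^-1) ^+ 2 = t * ((a - a^-1) ^+ 2 + 4) ->
  hellinger (offspring v :&: B) v (root_marginal v) d ->
  hellinger (subtree v :&: B) p (down_marginal v) (t * d).
Proof.
move=> vp vL vB d0 ht H s.
have pv := child_neq vp.
have -> : subtree v :&: B = offspring v :&: B.
  rewrite subtreeE setIUl; apply/setUidPr; apply/subsetP => x; rewrite !inE.
  by move=> /andP [/eqP -> ]; rewrite (negbTE vB).
set S := offspring v :&: B.
pose m x y := root_marginal v (upd y v x).
have m0 x y : 0 < m x y by apply: root_marginal_gt0.
have nE x y : down_marginal v (upd y p x) = bond true x * m true y + bond false x * m false y.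
  rewrite (down_marginalE _ vp vL) updE /m.
  by congr (_ * _ + _ * _); rewrite upd_updC // root_marginal_parent.
set Z1 := block_sum S (m true) s; set Z2 := block_sum S (m false) s.
pose H1 := block_sum S (fun y => Num.sqrt (m true y * m false y)) s.
have hH : (1 - d) * (Z1 * Z2) <= H1 ^+ 2 by apply: H.
have av : a * a^-1 = 1 by rewrite divff // gt_eqF // a_gt0.
have aa : 0 <= a - a^-1.
  by rewrite subr_ge0 (le_trans _ a_ge1) // invf_le1 // a_gt0.
have s1 : block_sum S (fun y => down_marginal v (upd y p true)) s = a * Z1 + a^-1 * Z2.
  rewrite /Z1 /Z2 /block_sum !mulr_sumr -big_split; apply: eq_bigr => y _.
  by rewrite nE.
have s2 : block_sum S (fun y => down_marginal v (upd y p false)) s = a^-1 * Z1 + a * Z2.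
  rewrite /Z1 /Z2 /block_sum !mulr_sumr -big_split; apply: eq_bigr => y _.
  by rewrite nE.
have mink : (Z1 + Z2) ^+ 2 + ((a - a^-1) * H1) ^+ 2 <= (block_sum S
   (fun y => Num.sqrt (down_marginal v (upd y p true) * down_marginal v (upd y p false))) s) ^+ 2.
  rewrite /Z1 /Z2 /H1 /block_sum mulr_sumr -big_split.
  apply: (le_trans (minkowski_sqrt _ _ _)) => /=.
  - by move=> y; rewrite addr_ge0 // ltW.
  - by move=> y; rewrite mulr_ge0 // sqrtr_ge0.
  rewrite le_eqVlt; apply/orP; left; apply/eqP; congr (_ ^+ 2).
  apply: eq_bigr => y _; congr Num.sqrt.
  rewrite !nE /= exprMn sqr_sqrtr; last by rewrite mulr_ge0 // ltW.
  rewrite /bond /=; field; by rewrite gt_eqF // a_gt0.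
rewrite s1 s2; apply: le_trans mink; rewrite exprMn.
have Z1p : 0 <= Z1 by apply: block_sum_ge0 => y; apply: ltW.
have Z2p : 0 <= Z2 by apply: block_sum_ge0 => y; apply: ltW.
set k := (a - a^-1) ^+ 2 in ht *.
have k0 : 0 <= k by apply: sqr_ge0.
have -> : (a * Z1 + a^-1 * Z2) * (a^-1 * Z1 + a * Z2) = (Z1 + Z2) ^+ 2 + k * (Z1 * Z2).
  by rewrite /k; field; rewrite gt_eqF // a_gt0.
have t0 : 0 <= t by nra.
have := ler_wpM2l k0 hH.
have q0 : 0 <= Z1 * Z2 by rewrite mulr_ge0.
(* The relation between [t] and [k] turns the slack left after using [hH] into
   [t * d * (Z1 - Z2)^2]. *)
have e1 : k * (Z1 * Z2) = t * (k * (Z1 * Z2) + 4 * (Z1 * Z2)) by rewrite {1}ht; ring.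
have e2 : 0 <= t * d * ((Z1 + Z2) ^+ 2 - 4 * (Z1 * Z2)).
  rewrite mulr_ge0 ?mulr_ge0 //; have := sqr_ge0 (Z1 - Z2); lra.
have e3 : d * (k * (Z1 * Z2)) = d * (t * (k * (Z1 * Z2) + 4 * (Z1 * Z2))) by rewrite -e1.
lra.
Qed.

End Hellinger.

(** * Decay of correlations at criticality *)

Definition lt_level r := [set u | (lev u < r)%N].
Definition in_levels r h := [set u | (r <= lev u < h)%N].

Section Decay.
Variables (r h : nat).
Hypotheses (b_gt1 : (1 < b)%N) (rh : (r <= h)%N).
(** With [a = exp beta], and since [(a - 1/a)^2 + 4 = (a + 1/a)^2], this reads
    [tanh(beta)^2 = 1/b]. *)
Hypothesis critical : (a - a^-1) ^+ 2 = b%:R^-1 * ((a - a^-1) ^+ 2 + 4).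

Let L := lt_level r.
Let B := in_levels r h.

(** [n] counts the levels strictly between [v] and level [r]. With none, the trivial bound [1] is
    [4 / 4]; each further level costs an edge, with factor [1/b], and then a product over
    children. *)
Lemma hellinger_decay n v : (lev v + n.+1 = r)%N ->
  hellinger (offspring v :&: B) v (root_marginal L v) (4 / (n%:R + 4)).
Proof.
elim: n v => [|n IH] v lv.
  by rewrite add0r divff ?pnatr_eq0 //; apply: hellinger1.
pose d : R := 4 / (n%:R + 4).
have n4 : 0 < n%:R + 4 :> R by rewrite ltr_wpDl.
have dE : d * (n%:R + 4) = 4 by rewrite divfK // gt_eqF.
have d0 : 0 <= d by rewrite divr_ge0 // ltW.
have n0 : 0 <= n%:R :> R by [].
have d1 : d <= 1 by nra.
have bp : 1 <= b%:R :> R by rewrite ler1n ltnW.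
have bv : b%:R * b%:R^-1 = 1 :> R by rewrite divff // gt_eqF // (lt_le_trans ltr01).
have bi : 0 <= b%:R^-1 :> R by rewrite invr_ge0.
have bi1 : b%:R^-1 <= 1 :> R by nra.
have e0 : 0 <= b%:R^-1 * d by rewrite mulr_ge0.
have e1 : b%:R^-1 * d <= 1 by nra.
apply: (@hellinger_le _ _ _ (1 - (1 - b%:R^-1 * d) ^+ b)).
- by move=> s; rewrite ltW ?root_marginal_gt0.
- have /= := @pow_one_sub_ge R b (b%:R^-1 * d) b_gt1 e0; rewrite mulrA bv mul1r.
  move=> /(_ d1) K.
  (* [4 / (n + 4)] dominates the recursion: with [i = 1 / (n + 4)], clearing the denominator [n + 5]
     leaves the surplus [4 * i^2]. *)
  suff : d - d ^+ 2 / 4 <= 4 / (n.+1%:R + 4) by lra.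
  have n5 : 0 < n%:R + 1 + 4 :> R by lra.
  rewrite -[n.+1%:R]natr1 ler_pdivlMr //.
  have -> : d = 4 * (n%:R + 4)^-1 by [].
  set i := (n%:R + 4)^-1.
  have iE : (n%:R + 4) * i = 1 by rewrite divff // gt_eqF.
  have i0 : 0 <= i by rewrite invr_ge0 ltW.
  have -> : n%:R + 1 + 4 = (n%:R + 4) + 1 :> R by ring.
  rewrite -subr_ge0.
  have -> : 4 - (4 * i - (4 * i) ^+ 2 / 4) * (n%:R + 4 + 1)
     = 4 - 4 * ((n%:R + 4) * i) - 4 * i + 4 * i * ((n%:R + 4) * i) + 4 * i ^+ 2 by field.
  rewrite iE; have := sqr_ge0 i; lra.
apply: hellinger_root; first by rewrite e0 e1.
move=> c cv; have lc := lev_child cv.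
apply: hellinger_channel => //; rewrite ?inE.
- by clear -lc lv; lia.
- by clear -lc lv; rewrite negb_and; apply/orP; left; lia.
by apply: IH; clear -lc lv; lia.
Qed.

(** The edges outside [offspring v] factor out. As [g] does not read [L], these levels can be summed
    first, turning the edge weights inside [offspring v] into [root_marginal]. *)
Lemma root_block_sum v g s : (lev v < r)%N ->
  indep (subtree v :&: L) g ->
  block_sum (offspring v :&: lt_level h) (fun t => ising t * g t) s
  = bonds (~: offspring v) s
    * block_sum (offspring v :&: B) (fun y => g y * root_marginal L v y) s.
Proof.
move=> lv gi.
have -> : offspring v :&: lt_level h = (offspring v :&: B) :|: (offspring v :&: L).
  rewrite -setIUr; congr (_ :&: _); apply/setP => u; rewrite !inE; lia.
rewrite -block_sumZ; last first.
  apply: indep_sub (subsetIl _ B) _; apply: bonds_indep (@closed_offspring v) _.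
  by rewrite disjoints_subset.
rewrite block_sumU; last first.
  rewrite disjoints_subset; apply/subsetP => u; rewrite !inE; lia.
apply: eq_block_sum => t; rewrite /root_marginal -!block_sumZ.
- apply: eq_block_sum => y; rewrite (ising_split (offspring v)); ring.
- apply: indep_sub (subsetIl _ L) _; apply: bonds_indep (@closed_offspring v) _.
  by rewrite disjoints_subset.
by apply: indep_sub gi; rewrite subtreeE setSI // subsetUr.
Qed.

(** On each class the spin of [v] is a binary variable observed through the levels from [r] on, and
    [hellinger_variance] limits the share of the variance of [g] that this spin explains. *)
Lemma sqn_root_le d v g : (lev v < r)%N ->
  hellinger (offspring v :&: B) v (root_marginal L v) d ->
  indep (subtree v :&: L) g ->
  nrm (E (offspring v :&: lt_level h) g)
  <= d * nrm g + (1 - d) * nrm (E (subtree v :&: lt_level h) g).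
Proof.
move=> lv H gi.
set S := offspring v :&: lt_level h; set D := subtree v :&: lt_level h.
have DE : D = [set v] :|: S.
  rewrite /D subtreeE setIUl; congr (_ :|: _); apply/setIidPl.
  by rewrite sub1set inE (leq_trans lv).
have vS : v \notin S by rewrite !inE eqxx.
have vD : [disjoint [set v] & S] by rewrite disjoints1.
have sumD F s : block_sum D F s = block_sum S F (upd s v true) + block_sum S F (upd s v false).
  by rewrite DE block_sumU // block_sum1.
(* It suffices to work class by class, since averaging over [D] preserves total integrals. *)
suff pw s : E D (fun t => E S g t ^+ 2) s
    <= d * E D (fun t => g t ^+ 2) s + (1 - d) * E D g s ^+ 2.
  have nE f : nrm f = ip ising (fun t => f t ^+ 2) (fun=> 1).
    by apply: eq_bigr => t _; ring.
  rewrite !nE -(condexp_ip Wp (S := D) (fun t => E S g t ^+ 2)) //.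
  rewrite -(condexp_ip Wp (S := D) (fun t => g t ^+ 2)) //.
  rewrite /ip !mulr_sumr -big_split; apply: ler_sum => t _ /=.
  by rewrite !mulr1 !(mulrCA _ (ising t)) -mulrDr ler_pM2l // pw.
have gv y x : g (upd y v x) = g y.
  apply/esym; apply: gi; apply: agree_sub (agree_upd1 _ _ _).
  by rewrite sub1set !inE below_refl.
(* The prior for [hellinger_variance]: all edges outside [offspring v], the one above [v]
   included. *)
pose rho x := bonds (~: offspring v) (upd s v x).
pose m x y := root_marginal L v (upd y v x).
have sumg (f : C -> R) x : (forall y x, f (upd y v x) = f y) ->
    indep (subtree v :&: L) f ->
    block_sum S (fun t => ising t * f t) (upd s v x)
    = rho x * \sum_(y | agree (offspring v :&: B) s y) f y * m x y.
  move=> fv fi; rewrite root_block_sum // block_sum_upd; last by rewrite !inE eqxx.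
  by congr (_ * _); apply: eq_bigr => y _; rewrite fv.
have sum1 x : block_sum S ising (upd s v x)
    = rho x * \sum_(y | agree (offspring v :&: B) s y) m x y.
  transitivity (block_sum S (fun t => ising t * (fun=> 1) t) (upd s v x)).
    by apply: eq_block_sum => t; rewrite mulr1.
  by rewrite sumg //; congr (_ * _); apply: eq_bigr => y _; rewrite mul1r.
have rho0 x : 0 < rho x by apply: bonds_gt0.
have m0 x y : 0 < m x y by apply: root_marginal_gt0.
have sumsq x : block_sum S (fun t => ising t * E S g t ^+ 2) (upd s v x)
    = block_sum S (fun t => ising t * g t) (upd s v x) ^+ 2
      / block_sum S ising (upd s v x).
  transitivity (block_sum S (fun t => E S g t ^+ 2 * ising t) (upd s v x)).
    by apply: eq_block_sum => t; rewrite mulrC.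
  rewrite block_sumZ; last by move=> y y' yy; rewrite (@condexp_indep _ _ _ S g _ _ yy).
  by rewrite /condexp; field; apply: block_sumW_neq0.
have Z0 x : \sum_(y | agree (offspring v :&: B) s y) m x y != 0.
  rewrite gt_eqF // (bigD1 s) ?agree_refl //= ltr_wpDr ?sumr_ge0 // => y _.
  exact: ltW.
have gv2 y x : g (upd y v x) ^+ 2 = g y ^+ 2 by rewrite gv.
have gi2 : indep (subtree v :&: L) (fun t => g t ^+ 2).
  by move=> y y' /gi ->.
have hv := @hellinger_variance R _ (agree (offspring v :&: B) s)
  (m true) (m false) g (rho true) (rho false) d s (agree_refl _ _)
  (m0 true) (m0 false) (rho0 true) (rho0 false) (H s).
move: hv => /=.
have EDE (f : C -> R) :
  E D f s = block_sum D (fun t => ising t * f t) s / block_sum D ising s by [].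
rewrite !EDE !sumD !sumsq !sum1 !sumg //.
set Z1 := \sum_(y | _) m true y; set Z2 := \sum_(y | _) m false y.
set a1 := \sum_(y | _) g y * m true y; set a2 := \sum_(y | _) g y * m false y.
set q1 := \sum_(y | _) g y ^+ 2 * m true y; set q2 := \sum_(y | _) g y ^+ 2 * m false y.
have r1 : rho true != 0 by rewrite gt_eqF.
have r2 : rho false != 0 by rewrite gt_eqF.
have Z10 : Z1 != 0 by apply: Z0.
have Z20 : Z2 != 0 by apply: Z0.
have Zp x : 0 < \sum_(y | agree (offspring v :&: B) s y) m x y.
  by rewrite lt_neqAle eq_sym Z0 sumr_ge0 // => y _; apply: ltW.
have Np : 0 < rho true * Z1 + rho false * Z2.
  by apply: addr_gt0; apply: mulr_gt0 => //; apply: Zp.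
have N0 : rho true * Z1 + rho false * Z2 != 0 by rewrite gt_eqF.
move=> hv; rewrite -(ler_pM2r Np).
have -> : ((rho true * a1) ^+ 2 / (rho true * Z1) + (rho false * a2) ^+ 2 / (rho false * Z2))
    / (rho true * Z1 + rho false * Z2) * (rho true * Z1 + rho false * Z2)
   = rho true * (a1 ^+ 2 / Z1) + rho false * (a2 ^+ 2 / Z2).
  by rewrite divfK //; field; rewrite ?r1 ?r2 ?Z10 ?Z20.
apply: (le_trans hv); rewrite le_eqVlt; apply/orP; left; apply/eqP; field.
by rewrite ?N0.
Qed.

Variable l : nat.
Hypothesis (lr : (l < r)%N).
Let delta : R := 4 / ((r - l)%:R + 4).

Lemma delta01 : 0 <= delta <= 1.
Proof.
have n0 : 0 <= (r - l)%:R :> R by [].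
have n4 : 0 < (r - l)%:R + 4 :> R by lra.
by rewrite divr_ge0 ?ler_pdivrMr //=; lra.
Qed.

(** At least [r - l] levels lie strictly between [v] and level [r], so [delta] dominates the decay
    bound. *)
Lemma hellinger_top v : (lev v < l)%N ->
  hellinger (offspring v :&: B) v (root_marginal L v) delta.
Proof.
move=> lv; pose n := (r - (lev v).+1)%N.
have rn : (r - l <= n)%N by rewrite /n; clear -lv lr; lia.
apply: hellinger_le (hellinger_decay (n := n) _).
- by move=> s; rewrite ltW ?root_marginal_gt0.
- have n0 : 0 <= (r - l)%:R :> R by [].
  have nn : (r - l)%:R <= n%:R :> R by rewrite ler_nat.
  by rewrite ler_pM2l // lef_pV2 ?posrE; lra.
by rewrite /n; clear -lv lr; lia.
Qed.

(** Induction on the number of levels from [v] down to level [l]: the children tensorize with the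
    factor of the previous step, and the spin of [v] costs one more [1 - delta]. When the last norm
    vanishes, this bounds the squared correlation of [g] with the spins above level [l]. *)
Lemma sqn_levels_le k v g : (lev v + k = l)%N -> indep (subtree v :&: L) g ->
  nrm (E (subtree v :&: in_levels l h) g)
  <= (1 - (1 - delta) ^+ k) * nrm g
     + (1 - delta) ^+ k * nrm (E (subtree v :&: lt_level h) g).
Proof.
have /andP [d0 d1] := delta01.
have p0 : 0 <= 1 - delta by rewrite subr_ge0.
have p1 : 1 - delta <= 1 by rewrite gerBl.
elim: k v g => [|k IH] v g lk gi.
  rewrite expr0 subrr mul0r add0r mul1r; set S := _ :&: _; set S' := _ :&: _.
  suff -> : S = S' by [].
  apply/setP => u; rewrite !inE; case uv : (below u v) => //=.
  by have := lev_below uv; rewrite -lk addn0 => ->.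
have lv : (lev v < l)%N by rewrite -lk addnS ltnS leq_addr.
have -> : subtree v :&: in_levels l h = offspring v :&: in_levels l h.
  rewrite subtreeE setIUl; apply/setUidPr; apply/subsetP => x; rewrite !inE.
  by case/andP => /eqP ->; rewrite leqNgt lv.
have q0 : 0 <= (1 - delta) ^+ k by rewrite exprn_ge0.
have q1 : (1 - delta) ^+ k <= 1 by rewrite exprn_ile1.
have H1 := @sqn_siblings ((1 - delta) ^+ k) (lev v).+1 (children v)
  L (in_levels l h) (lt_level h).
rewrite -offspring_bigcup in H1.
have {}H1 := H1 _ (same_level_children v) _ g _.
rewrite q0 q1 in H1; have {}H1 := H1 isT.
have gi' : indep (offspring v :&: L) g.
  by apply: indep_sub gi; rewrite subtreeE setSI // subsetUr.
have {}H1 : nrm (E (offspring v :&: in_levels l h) g)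
    <= (1 - (1 - delta) ^+ k) * nrm g
       + (1 - delta) ^+ k * nrm (E (offspring v :&: lt_level h) g).
  apply: H1 gi' => c f; rewrite mem_children => cv fi; apply: IH => //.
  by rewrite (lev_child cv) -lk addnS addSn.
have H2 := sqn_root_le (ltn_trans lv lr) (hellinger_top lv) gi.
apply: (le_trans H1); rewrite exprS.
have := ler_wpM2l q0 H2; lra.
Qed.

(** Let [g] be the average of [f] over the root block. Its weak correlation with the levels above
    [l] bounds [c * nrm g] by the squared norm of [g - E (in_levels l h) g], hence by
    [2 * SU + 2 * VB]; adding back [VB] gives the factor 3. *)
Lemma block_poincare (root : V) U f : subtree root = setT -> lev root = 0%N ->
  same_level l U -> \bigcup_(u <- U) subtree u :&: lt_level h = in_levels l h ->
  (forall s, E (lt_level h) f s = 0) ->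
  (1 - l%:R * delta) * nrm f
  <= 3 * (nrm (fun s => f s - E (lt_level r) f s)
          + \sum_(u <- U) nrm (fun s => f s - E (subtree u :&: lt_level h) f s)).
Proof.
move=> rT r0 slU cov f0.
set VB := nrm (fun s => f s - E (lt_level r) f s); set SU := \sum_(_ <- _) _.
have VA : nrm (fun s => f s - E (in_levels l h) f s) <= SU.
  by rewrite -cov; apply: efron_stein_siblings slU.
pose g := E (lt_level r) f.
have gi : indep (subtree root :&: L) g by rewrite rT setTI; apply: condexp_indep.
have := sqn_levels_le (k := l) _ gi; rewrite r0 => /(_ (add0n l)).
rewrite rT !setTI.
(* [g] inherits mean zero from [f] by the tower property. *)
have -> : nrm (E (lt_level h) g) = 0.
  rewrite -condexp_ip_self // /g condexp_ip //; last first.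
    apply: indep_sub (condexp_indep _ _ (S := lt_level h)).
    by apply/subsetP => u; rewrite !inE => /leq_trans; apply.
  rewrite -(condexp_ip Wp (S := lt_level h)); last exact: condexp_indep.
  by rewrite /ip big1 // => s _; rewrite f0 mulr0 mul0r.
set c := (1 - delta) ^+ l.
have cl : 1 - l%:R * delta <= c by apply: bernoulli delta01.
have /andP [d0 d1] := delta01.
have c0 : 0 <= c by rewrite exprn_ge0 // subr_ge0.
have c1 : c <= 1 by rewrite exprn_ile1 ?subr_ge0 // gerBl.
move=> H1.
(* Write [g] as [f - (f - g)]; subtracting the conditional expectation is a contraction. *)
have gB : nrm (fun s => g s - E (in_levels l h) g s) <= 2 * SU + 2 * VB.
  rewrite (@eq_sqn _ _ _ _ (fun s => (f s - E (in_levels l h) f s)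
     - ((f s - g s) - E (in_levels l h) (fun t => f t - g t) s))); last first.
    by move=> s; rewrite condexpB; ring.
  apply: (le_trans (sqnB_le Wp _ _)).
  have K : nrm (fun s => (f s - g s) - E (in_levels l h) (fun t => f t - g t) s)
      <= nrm (fun t => f t - g t).
    by rewrite (sqn_sub_condexp Wp _ (fun t => f t - g t)) gerBl sqn_ge0.
  have e : nrm (fun t => f t - g t) = VB by [].
  rewrite e in K; lra.
rewrite sqn_sub_condexp // in gB.
have fB : VB = nrm f - nrm g by apply: sqn_sub_condexp.
have nf : 0 <= nrm f by apply: sqn_ge0.
have nB : 0 <= VB by apply: sqn_ge0.
have nA : 0 <= SU by apply: le_trans VA; apply: sqn_ge0.
apply: (le_trans (ler_wpM2r nf cl)).
have -> : nrm f = VB + nrm g by rewrite fB; ring.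
have := ler_wpM2r nB c1; lra.
Qed.

End Decay.
End TreeIsing.

(** * The tree of words and the block dynamics *)

Section Words.
Variables (b h : nat).
Implicit Types u v c : vtx b h.

Lemma size_word v : size (word v) = depth v.
Proof. by rewrite size_map size_tuple. Qed.

Lemma depth_le v : (depth v <= h)%N.
Proof. by rewrite -ltnS ltn_ord. Qed.

Lemma word_inj : injective (@word b h).
Proof.
move=> u v uv; have d : depth u = depth v by rewrite -!size_word uv.
case: u uv d => k t; case: v => k' t'; rewrite /word /depth /= => tt' /val_inj kk.
subst k'; congr existT; apply: val_inj.
exact: inj_map (@ord_inj b) _ _ tt'.
Qed.

Lemma prefix_vtx u k : (k <= depth u)%N ->
  exists2 c : vtx b h, depth c = k & word c = take k (word u).
Proof.
move=> ku; have kh : (k < h.+1)%N by rewrite ltnS (leq_trans ku) ?depth_le.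
have sz : size (take k (tagged u)) == k by rewrite size_takel // size_tuple.
exists (existT (fun k : 'I_h.+1 => k.-tuple 'I_b) (Ordinal kh) (Tuple sz)) => //.
by rewrite /word /= map_take.
Qed.

Lemma desc_refl v : desc v v.
Proof. by rewrite /desc leqnn -size_word take_size eqxx. Qed.

Lemma desc_inv u v : desc u v -> u = v \/ exists2 c : vtx b h, child c v & desc u c.
Proof.
move=> /andP [vu /eqP wv]; case: (ltngtP (depth v) (depth u)) vu => // [lt _|e _].
  right; have [c dc wc] := prefix_vtx lt.
  exists c; first by rewrite /child dc eqxx wc take_takel // wv eqxx.
  by rewrite /desc dc lt wc eqxx.
by left; apply: word_inj; rewrite wv e -size_word take_size.
Qed.

Lemma desc_inj u v v' : desc u v -> desc u v' -> depth v = depth v' -> v = v'.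
Proof.
move=> /andP [_ /eqP wv] /andP [_ /eqP wv'] e; apply: word_inj.
by rewrite wv wv' e.
Qed.

Lemma word_lt v i : i \in word v -> (i < b)%N.
Proof. by move=> /mapP [j _ ->]. Qed.

Lemma card_children_le v : (#|[set c | child c v]| <= b)%N.
Proof.
rewrite cardE -(size_map (@word b h)) -[X in (_ <= X)%N](size_iota 0).
rewrite -(size_map (rcons (word v))); apply: uniq_leq_size.
  by rewrite map_inj_uniq ?enum_uniq //; apply: word_inj.
move=> w /mapP [c]; rewrite mem_enum inE => /andP [/eqP dc /eqP wv] ->.
have sc : size (word c) = (depth v).+1 by rewrite size_word dc.
apply/mapP; exists (nth 0%N (word c) (depth v)).
  by rewrite mem_iota /= add0n (@word_lt c) // mem_nth // sc.
by rewrite wv -take_nth ?sc // -sc take_size.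
Qed.

Definition vtx_tree : tree (vtx b h) b.
Proof.
apply: (@Tree _ _ depth child desc) => [v|c v|u v|u c v|u p v|u v|u v v'|v].
- exact: desc_refl.
- by case/andP => /eqP.
- by case/andP.
- move=> /andP [/eqP dc /eqP wv] /andP [cu /eqP wc]; rewrite dc in cu wc.
  by rewrite /desc (ltnW cu) wv wc take_takel ?eqxx.
- move=> /andP [/eqP du /eqP wp] /andP [vp /eqP wv].
  by rewrite /desc du (leqW vp) wv wp take_takel ?eqxx.
- exact: desc_inv.
- exact: desc_inj.
- exact: card_children_le.
Defined.

Definition root_vtx : vtx b h :=
  existT (fun k : 'I_h.+1 => k.-tuple 'I_b) ord0 [tuple].

Lemma depth0 v : depth v = 0%N -> v = root_vtx.
Proof.
move=> dv; apply: word_inj; apply: size0nil.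
by rewrite size_word dv.
Qed.

Lemma desc_root v : desc v root_vtx.
Proof. by rewrite /desc /= take0. Qed.

Definition level_seq (l : nat) : seq (vtx b h) := enum [set v | depth v == l].

Lemma mem_level_seq l v : (v \in level_seq l) = (depth v == l).
Proof. by rewrite mem_enum inE. Qed.

Lemma same_level_seq l : same_level vtx_tree l (level_seq l).
Proof.
by rewrite /same_level enum_uniq; apply/allP => v; rewrite mem_level_seq.
Qed.

Lemma size_level_seq l : (l <= h)%N -> size (level_seq l) = (b ^ l)%N.
Proof.
move=> lh; have lt : (l < h.+1)%N by [].
pose F (t : l.-tuple 'I_b) : vtx b h :=
  existT (fun k : 'I_h.+1 => k.-tuple 'I_b) (Ordinal lt) t.
have Finj : injective F.
  move=> t t' /(congr1 (@word b h)) /= tt'; apply: val_inj.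
  exact: inj_map (@ord_inj b) _ _ tt'.
have <- : #|{: l.-tuple 'I_b}| = (b ^ l)%N by rewrite card_tuple card_ord.
rewrite -cardE -cardsT -(card_imset _ Finj).
congr #|pred_of_set _|; apply/setP => v; rewrite inE; apply/eqP/imsetP => [dv|[t _ ->] //].
have sz : size (tagged v) == l by rewrite size_tuple -dv.
by exists (Tuple sz) => //; apply: word_inj.
Qed.

(** As [l > 0], the root is not on level [l] and is counted once, whence [b^l + 1] blocks. *)
Lemma perm_centers l : (0 < l)%N -> perm_eq (centers b h l) (root_vtx :: level_seq l).
Proof.
move=> l0; apply: uniq_perm => [||v].
- by rewrite filter_uniq // enum_uniq.
- by rewrite /= enum_uniq andbT mem_level_seq /= eq_sym -lt0n.
rewrite mem_filter mem_enum andbT inE mem_level_seq; congr (_ || _).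
by apply/eqP/eqP => [/depth0|->].
Qed.

End Words.

(** * From block kernels to conditional expectations under the Ising weight *)

Lemma RsumE (I : Type) (s : seq I) (F : I -> R) : Rsum s F = \sum_(i <- s) F i.
Proof. by elim: s => [|i s IH]; rewrite ?big_nil ?big_cons //= IH. Qed.

Lemma exp_sum (I : Type) (s : seq I) (P : pred I) (F : I -> R) :
  exp (\sum_(i <- s | P i) F i) = \prod_(i <- s | P i) exp (F i).
Proof.
apply: (big_morph exp) => [x y|]; last exact: exp_0.
by rewrite -[x + y]/(Rplus x y) exp_plus.
Qed.

Lemma exp_gt0 (x : R) : 0 < exp x.
Proof. by apply/RltP; apply: exp_pos. Qed.

Section BlockDynamics.
Variables (b h : nat) (beta : R) (tau : config b h).
Hypothesis beta_ge1 : 1 <= exp beta.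
Local Notation T := (vtx_tree b h).
Local Notation W := (@ising R _ _ T (exp beta)).
Implicit Types (s t : config b h) (v : vtx b h).

Lemma bond_expE (x y : bool) :
  exp (beta * ((if x then 1 else -1) * (if y then 1 else -1)))%R = bond (exp beta) x y.
Proof.
have eN : exp (- beta)%R = (exp beta)^-1 by exact: exp_Ropp.
by case: x; case: y; rewrite /bond /= ?mulrNN ?mul1r ?mulr1 ?mulrN ?mulr1 ?eN.
Qed.

(** [energy] runs over ordered pairs (child, parent), so each edge occurs once, at its lower
    endpoint as in [bonds]. *)
Lemma weightE s : weight beta s = W s.
Proof.
rewrite /weight /energy RsumE -[Rmult _ _]/(beta * _) mulr_sumr exp_sum.
rewrite /ising /bonds big_enum /=; apply: eq_big => u; first by rewrite !inE.
move=> _; rewrite RsumE mulr_sumr exp_sum big_enum [RHS]big_mkcond /=.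
apply: eq_bigr => p _; case: ifP => _; last by rewrite mulr0 exp_0.
exact: bond_expE.
Qed.

Lemma weight_gt0 s : 0 < weight beta s.
Proof. exact: exp_gt0. Qed.

Definition bdry s := [forall v, is_leaf v ==> (s v == tau v)].

Lemma mem_Omega s : (s \in Omega tau) = bdry s.
Proof. by rewrite mem_filter mem_enum andbT. Qed.

Lemma RsumOmega (F : config b h -> R) : Rsum (Omega tau) F = \sum_(s | bdry s) F s.
Proof. by rewrite RsumE big_filter big_enum_cond. Qed.

Lemma bdryP s : reflect (forall v, depth v = h -> s v = tau v) (bdry s).
Proof.
apply: (iffP 'forall_implyP) => [H v /eqP /H /eqP //|H v /eqP /H ->] //.
Qed.

Lemma bdry_agree (S : {set vtx b h}) s t : S \subset lt_level T h ->
  agree S s t -> bdry s = bdry t.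
Proof.
move=> /subsetP sub /agreeP st.
have lf v : depth v = h -> s v = t v.
  by move=> dv; apply: st; apply/negP => /sub; rewrite inE /= dv ltnn.
by apply/bdryP/bdryP => H v dv; rewrite -H // lf.
Qed.

(* The leaves are kept as ordinary spins with positive weight: no block contains
   them, so conditioning on [tau] amounts to extending functions by zero. *)
Definition zero_ext (f : config b h -> R) s : R := if bdry s then f s else 0.

Lemma condexp_zero_ext (S : {set vtx b h}) f s : S \subset lt_level T h ->
  ~~ bdry s -> condexp W S (zero_ext f) s = 0.
Proof.
move=> sub sb; rewrite /condexp /block_sum big1 ?mul0r // => t st.
by rewrite /zero_ext -(bdry_agree sub st) (negbTE sb) mulr0.
Qed.

Definition block v r : {set vtx b h} := [set u | inB v r u].

Lemma agree_offE v r s t : agree_off v r s t = agree (block v r) s t.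
Proof. by apply: eq_forallb => u; rewrite inE. Qed.

Lemma partition_gt0 : 0 < Rsum (Omega tau) (weight beta).
Proof.
rewrite RsumOmega (bigD1 tau) /=; last exact/bdryP.
by rewrite ltr_wpDr ?weight_gt0 // sumr_ge0 // => t _; rewrite ltW ?weight_gt0.
Qed.

(** A block without leaves keeps the class of [s] inside [Omega tau], and the partition function
    cancels in the ratio. *)
Lemma block_kernelE v r f s : block v r \subset lt_level T h -> bdry s ->
  Rsum (Omega tau) (fun t => (block_kernel beta tau v r s t * f t)%R)
  = condexp W (block v r) (zero_ext f) s.
Proof.
move=> sub sb; set Z := Rsum (Omega tau) (weight beta).
have Z0 : Z != 0 by rewrite gt_eqF // partition_gt0.
have cls t : agree (block v r) s t -> bdry t by move=> /(bdry_agree sub) <-.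
have den : Rsum [seq e <- Omega tau | agree_off v r s e] (mu beta tau)
    = block_sum (block v r) W s / Z.
  rewrite RsumE /Omega -filter_predI big_filter big_enum_cond /block_sum mulr_suml.
  apply: eq_big => t; last by move=> _; rewrite /mu RdivE weightE.
  rewrite /= agree_offE; case ag : (agree _ _ _) => //=.
  by have := cls _ ag; rewrite /bdry => ->.
transitivity (\sum_(t | agree (block v r) s t)
    W t * zero_ext f t / block_sum (block v r) W s); last by rewrite -mulr_suml.
rewrite RsumOmega big_mkcond [RHS]big_mkcond /=; apply: eq_bigr => t _.
rewrite /block_kernel agree_offE; case ag : (agree _ _ _); last first.
  by rewrite R0E mul0r if_same.
rewrite /zero_ext cls // RdivE den /mu RdivE weightE -/Z.
by field; rewrite Z0 block_sumW_neq0 //; apply: ising_gt0.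
Qed.

Variables (l : nat).
Local Notation r := (h - l)%N.
Hypotheses (l0 : (0 < l)%N) (lr : (l < r)%N).

Lemma block_root : block (root_vtx b h) r = lt_level T r.
Proof. by apply/setP => u; rewrite !inE /inB desc_root add0n. Qed.

Lemma block_level v : depth v = l -> block v r = subtree T v :&: lt_level T h.
Proof.
move=> dv; apply/setP => u; rewrite !inE /inB /= dv subnKC //.
by clear -lr; lia.
Qed.

Lemma block_center_sub v : v \in centers b h l -> block v r \subset lt_level T h.
Proof.
rewrite (perm_mem (perm_centers b h l0)) inE mem_level_seq => /orP [/eqP ->|/eqP dv].
  by rewrite block_root; apply/subsetP => u; rewrite !inE => /leq_trans; apply; apply: leq_subr.
by rewrite (block_level dv) subsetIr.
Qed.

Local Notation nrm := (sqn W).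
Let Wp := ising_gt0 T beta_ge1.

Section Eigenfunction.
Variables (lam : R) (f : config b h -> R).
Hypothesis f_neq0 : exists s, s \in Omega tau /\ f s <> 0.
Hypothesis f_mean : Rsum (Omega tau) (fun s => mu beta tau s * f s)%R = 0.
Hypothesis f_eig : forall s, s \in Omega tau ->
  Rsum (Omega tau) (fun s' => block_P beta tau l r s s' * f s')%R = (lam * f s)%R.
Let F := zero_ext f.
Let N : R := (size (centers b h l))%:R.

Lemma size_centersE : N = b%:R ^+ l + 1.
Proof.
rewrite /N (perm_size (perm_centers b h l0)) /= size_level_seq; last by clear -lr; lia.
by rewrite -natr1 natrX.
Qed.

Lemma size_centers_gt0 : 0 < N.
Proof. by rewrite size_centersE ltr_wpDl // exprn_ge0. Qed.

(** The eigenvalue equation extends to all configurations, both sides vanishing where the boundary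
    condition fails. *)
Lemma eigen_zero_ext s : N * (lam * F s) = \sum_(v <- centers b h l) condexp W (block v r) F s.
Proof.
have N0 : N != 0 by rewrite gt_eqF ?size_centers_gt0.
case sb : (bdry s); last first.
  rewrite /F {1}/zero_ext sb !mulr0 big_seq big1 // => v /block_center_sub sub.
  by rewrite condexp_zero_ext ?sb.
rewrite {1}/F /zero_ext sb -f_eig ?mem_Omega //.
rewrite big_seq (eq_bigr (fun v => \sum_(t | bdry t) block_kernel beta tau v r s t * f t)).
  rewrite -big_seq exchange_big RsumOmega mulr_sumr; apply: eq_bigr => t _.
  rewrite /block_P RsumE INRE RinvE -mulr_suml -/N !mulrA.
  by rewrite divff // mul1r.
by move=> v /block_center_sub sub; rewrite -RsumOmega block_kernelE.
Qed.

(** For a boundary-compatible [s], the class obtained by freeing all non-leaf spins is exactly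
    [Omega tau], so this average is the mean under [mu]. *)
Lemma condexp_zero_ext_mean0 s : condexp W (lt_level T h) F s = 0.
Proof.
case sb : (bdry s); last by rewrite condexp_zero_ext ?sb.
rewrite /condexp; suff -> : block_sum (lt_level T h) (fun t => W t * F t) s = 0.
  by rewrite mul0r.
pose Z := Rsum (Omega tau) (weight beta).
have Z0 : Z != 0 by rewrite gt_eqF // partition_gt0.
apply: (mulIf (invr_neq0 Z0)); rewrite mul0r -[RHS]f_mean RsumOmega.
rewrite /block_sum mulr_suml; apply: eq_big => t.
  apply/idP/idP => [st|tb]; first by rewrite -(bdry_agree (subxx _) st).
  apply/agreeP => u; rewrite inE -leqNgt => hu.
  have du : depth u = h by apply/eqP; rewrite eqn_leq depth_le.
  by rewrite (bdryP _ sb _ du) (bdryP _ tb _ du).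
move=> st; rewrite /F /zero_ext -(bdry_agree (subxx _) st) sb /mu.
by rewrite RdivE weightE -/Z mulrAC.
Qed.

Lemma sqn_zero_ext_gt0 : 0 < nrm F.
Proof.
have [s [sO fs]] := f_neq0; rewrite mem_Omega in sO.
rewrite /sqn /ip (bigD1 s) //= ltr_wpDr //.
  by apply: sumr_ge0 => t _; rewrite -mulrA mulr_ge0 ?sqr_ge0 // ltW.
rewrite -mulrA mulr_gt0 // /F /zero_ext sO.
by rewrite lt_neqAle sqr_ge0 andbT eq_sym mulf_neq0 //; apply/eqP.
Qed.

(** Pair the eigenvalue equation with [F]; each block average is an orthogonal projection. *)
Lemma dirichlet_form : N * (1 - lam) * nrm F
  = \sum_(v <- centers b h l) nrm (fun s => F s - condexp W (block v r) F s).
Proof.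
have -> : N * (1 - lam) * nrm F = N * nrm F - \sum_s W s * (N * (lam * F s)) * F s.
  rewrite /sqn /ip !mulr_sumr -sumrB; apply: eq_bigr => s _; ring.
under [X in _ - X]eq_bigr do rewrite eigen_zero_ext mulr_sumr mulr_suml.
rewrite exchange_big /=.
have -> : N * nrm F = \sum_(v <- centers b h l) nrm F.
  by rewrite /N; elim: (centers b h l) => [|v U IH];
    rewrite ?big_nil ?mul0r // big_cons -IH /= -nat1r mulrDl mul1r.
rewrite -sumrB; apply: eq_bigr => v _.
by rewrite sqn_sub_condexp // -condexp_ip_self // [in RHS]ipC.
Qed.

End Eigenfunction.
End BlockDynamics.

(** * The critical temperature and the explicit constant *)

Lemma exp_atanh_sqr (x : R) : -1 < x < 1 -> exp (atanh x) ^+ 2 = (1 + x) / (1 - x).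
Proof.
move=> /andP [x0 x1]; rewrite expr2 -[LHS]/(Rmult _ _) -exp_plus /atanh.
set y := ln _.
have -> : Rplus (Rmult (Rinv 2) y) (Rmult (Rinv 2) y) = y.
  rewrite -[LHS]/(2%:R^-1 * y + 2%:R^-1 * y); by field.
rewrite /y exp_ln ?RdivE //; apply/RltP.
have e1 : 0 < 1 + x by lra.
have e2 : 0 < 1 - x by lra.
exact: divr_gt0 e1 e2.
Qed.

Lemma inv_sqrt_sqr (b : nat) : (0 < b)%N ->
  ((Num.sqrt b%:R)^-1 : R) ^+ 2 = b%:R^-1.
Proof. by move=> b0; rewrite exprVn sqr_sqrtr. Qed.

Lemma inv_sqrt_itv (b : nat) : (2 <= b)%N -> 0 < ((Num.sqrt b%:R)^-1 : R) < 1.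
Proof.
move=> b2; have b1 : 1 < b%:R :> R by rewrite ltr1n.
have s1 : 1 < Num.sqrt b%:R :> R by rewrite -[ltLHS]sqrtr1 ltr_sqrt // (lt_trans ltr01).
by rewrite invr_gt0 (lt_trans ltr01 s1) invf_lt1 // (lt_trans ltr01 s1).
Qed.

(** With [t = tanh beta] one has [exp(2 beta) = (1 + t)/(1 - t)], and both sides equal
    [4 t^2 / (1 - t^2)]. *)
Lemma exp_atanh_critical (b : nat) : (2 <= b)%N ->
  let a := exp (atanh (Num.sqrt b%:R)^-1) in
  1 <= a /\ (a - a^-1) ^+ 2 = b%:R^-1 * ((a - a^-1) ^+ 2 + 4).
Proof.
move=> b2 a; have /andP [t0 t1] := inv_sqrt_itv b2.
have b0 : (0 < b)%N by apply: leq_trans b2.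
rewrite -(inv_sqrt_sqr b0).
set t := (Num.sqrt b%:R)^-1 in t0 t1 a *.
have a0 : 0 < a by apply: exp_gt0.
have a2 : a ^+ 2 = (1 + t) / (1 - t) by apply: exp_atanh_sqr; apply/andP; lra.
have t1' : 1 - t != 0 by rewrite gt_eqF // subr_gt0.
have t2' : 1 + t != 0 by rewrite gt_eqF // addr_gt0.
split.
  have : 1 <= a ^+ 2 by rewrite a2 ler_pdivlMr ?subr_gt0 //; lra.
  by rewrite expr_ge1 // ltW.
have -> : (a - a^-1) ^+ 2 = a ^+ 2 - 2 + (a ^+ 2)^-1.
  by field; rewrite gt_eqF.
by rewrite a2; field; rewrite t1' t2'.
Qed.

Lemma eigenvalue_bound (b h l : nat) (beta : R) (tau : config b h) (lam : R) :
  (2 <= b)%N -> (0 < l)%N -> (l < h - l)%N -> 1 <= exp beta ->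
  (exp beta - (exp beta)^-1) ^+ 2
    = b%:R^-1 * ((exp beta - (exp beta)^-1) ^+ 2 + 4) ->
  nontrivial_eigenvalue beta tau l (h - l) lam ->
  1 - l%:R * (4 / ((h - l - l)%:R + 4)) <= 4 * (b%:R ^+ l + 1) * (1 - lam).
Proof.
move=> b2 l0 lr beta1 crit [f [f_neq0 [f_mean f_eig]]].
have Fp := sqn_zero_ext_gt0 beta1 f_neq0.
have dir := dirichlet_form beta1 l0 lr f_eig.
rewrite (size_centersE b l0 lr) (perm_big _ (perm_centers b h l0)) big_cons /= in dir.
rewrite block_root in dir.
set F := zero_ext tau f in Fp dir.
set W := ising _ _ in Fp dir.
set VB := sqn W (fun s => F s - condexp W (lt_level (vtx_tree b h) (h - l)) F s) in dir.
have lvl : \sum_(v <- level_seq b h l)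
     sqn W (fun s => F s - condexp W (block v (h - l)) F s)
   = \sum_(v <- level_seq b h l) sqn W
       (fun s => F s - condexp W (subtree (vtx_tree b h) v :&: lt_level (vtx_tree b h) h) F s).
  rewrite big_seq [RHS]big_seq; apply: eq_bigr => v; rewrite mem_level_seq => /eqP dv.
  by rewrite (block_level lr dv).
rewrite lvl in dir.
(* The ancestor of a vertex at level [l] is its prefix of length [l]. *)
have cov : \bigcup_(u <- level_seq b h l) subtree (vtx_tree b h) u :&: lt_level (vtx_tree b h) h
    = in_levels (vtx_tree b h) l h.
  apply/setP => u; rewrite in_setI mem_bigcup_seq !inE; congr (_ && _).
  apply/hasP/idP => [[v]|lu].
    by rewrite mem_level_seq inE => /eqP <- /andP [].
  have [c dc wc] := prefix_vtx lu.
  by exists c; rewrite ?mem_level_seq ?dc // inE /= /desc dc lu wc eqxx.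
have rT : subtree (vtx_tree b h) (root_vtx b h) = setT.
  by apply/setP => u; rewrite !inE /= desc_root.
have := block_poincare beta1 b2 (leq_subr l h) crit lr rT (erefl _)
  (same_level_seq b h l) cov (condexp_zero_ext_mean0 f_mean).
rewrite -/F -/W -/VB -dir => pc.
(* The Dirichlet form is nonnegative, so the constant 3 may be relaxed to 4. *)
have d0 : 0 <= (b%:R ^+ l + 1) * (1 - lam) * sqn W F.
  rewrite dir addr_ge0 ?sqn_ge0 // ?sumr_ge0 // => *; rewrite ?sqn_ge0 //;
  exact: ising_gt0.
rewrite -(ler_pM2r Fp); lra.
Qed.

Local Open Scope R_scope.

Theorem theorem4p1 :
  exists kappa : R, / 100 < kappa /\
  forall (b h l : nat) (alpha : R),
    (2 <= b)%nat -> 0 < alpha < / 2 -> (0 < l)%nat -> INR l = alpha * INR h ->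
    let theta := / sqrt (INR b) in
    let beta_c := atanh theta in
    let r := (h - l)%nat in
    forall (tau : config b h) (lam : R),
      nontrivial_eigenvalue beta_c tau l r lam ->
      1 - lam >= / (4 * (INR b ^ l + 1)) *
                 (1 - alpha / (kappa * (1 - theta) * (1 - 2 * alpha))).
Proof.
have i2 : IZR 2 = 2%:R%R by rewrite IZRposE INRE.
have i4 : IZR 4 = 4%:R%R by rewrite IZRposE INRE.
have i100 : IZR 100 = 100%:R%R by rewrite IZRposE INRE.
(* [1/4] because [l * delta] is at most [4 * alpha / (1 - 2 * alpha)]; dividing by [1 - theta] only
   weakens the bound. *)
exists (/ 4); split; first by apply/RltP; rewrite i100 i4 !RinvE; lra.
move=> b h l alpha b2 [/RltP a0 /RltP a1] l0 lh theta beta_c r tau lam eig.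
rewrite R0E in a0; rewrite i2 RinvE in a1.
have thE : theta = (Num.sqrt b%:R)^-1%R by rewrite /theta RsqrtE INRE RinvE.
have /andP [t0 t1] := inv_sqrt_itv b2; rewrite -thE in t0 t1.
have [beta1 crit] := exp_atanh_critical b2; rewrite -thE in beta1 crit.
rewrite !INRE -[Rmult _ _]/(alpha * h%:R)%R in lh.
have lp : (0 < l%:R :> R)%R by rewrite ltr0n.
have hp : (0 < h%:R :> R)%R by rewrite -(pmulr_rgt0 _ a0) -lh.
(* [alpha < 1/2] places level [l] strictly above level [r = h - l]. *)
have lhR : (l%:R + l%:R < h%:R :> R)%R by rewrite lh; nra.
have lhN : (l + l < h)%N by rewrite -(ltr_nat R) natrD.
have lr : (l < h - l)%N by clear -lhN; lia.
have key := eigenvalue_bound b2 l0 lr beta1 crit eig.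
apply: Rle_ge; apply/RleP.
rewrite i4 i2 INRE RpowE.
set N := (b%:R ^+ l + 1)%R in key.
have Np : (0 < N)%R by rewrite ltr_wpDl // exprn_ge0.
rewrite -/N.
set x := (alpha / _).
suff : (1 - x <= 4 * N * (1 - lam))%R.
  move=> K.
  change ((4 * N)^-1 * (1 - x) <= 1 - lam)%R.
  by rewrite mulrC ler_pdivrMr ?mulr_gt0 // mulrC.
apply: le_trans key; rewrite lerD2l lerN2.
have a2p : (0 < 1 - 2 * alpha)%R by lra.
have xE : x = (4 * alpha / ((1 - theta) * (1 - 2 * alpha)))%R.
  have t0' : (1 - theta != 0)%R by rewrite gt_eqF // subr_gt0.
  have a0' : (1 - 2 * alpha != 0)%R by rewrite gt_eqF.
  change (alpha / (4^-1 * (1 - theta) * (1 - 2 * alpha))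
     = 4 * alpha / ((1 - theta) * (1 - 2 * alpha)))%R.
  by field; rewrite t0' a0'.
have hl : ((h - l - l)%:R = h%:R - l%:R - l%:R :> R)%R.
  by rewrite -subnDA natrB ?natrD; [ring|apply: ltnW].
rewrite xE hl lh.
have hd : (0 < h%:R - alpha * h%:R - alpha * h%:R + 4 :> R)%R by rewrite -lh; lra.
rewrite mulrA ler_pdivrMr // [leRHS]mulrAC ler_pdivlMr ?mulr_gt0 ?subr_gt0 //; last lra.
(* With denominators cleared, the slack is four times this term, from [1 - theta], plus
   [16 * alpha], from the [+ 4] in the decay rate. *)
have : (0 <= alpha * h%:R * (theta * (1 - 2 * alpha)))%R.
  by rewrite !mulr_ge0 // ltW.
lra.
Qed.
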